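(* Let $t \in \mathbb{N}$ and let $\pi : S^3 \to S^2$ be the Hopf map $\pi(a,b) = (|a|^2-|b|^2,\, 2ab)$. Let $Y$ be a $t$-design on $S^2$ and $\Gamma$ a $2t$-design [resp. $(2t+1)$-design] on $S^1$. For each $y \in Y$, take a $2t$-design [resp. $(2t+1)$-design] $\Gamma_y$ on the fiber $\pi^{-1}(y) \simeq S^1$. Then the finite subset $$X := \bigsqcup_{y \in Y} \Gamma_y$$ is a $2t$-design [resp. $(2t+1)$-design] on $S^3$ with $|X| = \sum_{y \in Y} |\Gamma_y|$.
   Context: Spheres: $S^3 = \{(a,b) \in \mathbb{C}^2 : |a|^2+|b|^2=1\} \subset \mathbb{C}^2 \simeq \mathbb{R}^4$, $S^2 = \{(\xi,\eta) \in \mathbb{R}\times\mathbb{C} : \xi^2+|\eta|^2=1\} \subset \mathbb{R}\times\mathbb{C} \simeq \mathbb{R}^3$, $S^1 = \{z \in \mathbb{C} : |z|=1\} \subset \mathbb{C} \simeq \mathbb{R}^2$. Designs: let $\mu_{S^d}$ be the spherical measure on the unit sphere $S^d \subset \mathbb{R}^{d+1}$ and $|S^d| = \mu_{S^d}(S^d)$. Let $P_t(S^d)$ be the space of restrictions to $S^d$ of polynomial functions on $\mathbb{R}^{d+1}$ with complex coefficients and degree at most $t$. A finite subset $X \subset S^d$ is a $t$-design on $S^d$ if $\frac{1}{|X|}\sum_{x\in X} f(x) = \frac{1}{|S^d|}\int_{S^d} f \, d\mu_{S^d}$ for all $f \in P_t(S^d)$. Fibers: the group $S^1$ acts on $S^3$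 from the right by $(a,b)\cdot z := (az, b\overline{z})$, and it acts simply transitively on each fiber $\pi^{-1}(y)$, $y \in S^2$. Fixing a base point $s_y \in \pi^{-1}(y)$ gives the identification $S^1 \simeq \pi^{-1}(y)$, $z \mapsto s_y \cdot z$. A design on $\pi^{-1}(y)$ means the image $\{ s_y \cdot \gamma \mid \gamma \in \Gamma'_y \}$ of a design $\Gamma'_y$ on $S^1$ of the same strength under this identification (this does not depend on the choice of $s_y$).
   Formalization: The formal theorem adds the hypothesis that every fiber design Γ_y has the same number of points as Γ; without it the claim fails, e.g. for t=1, Y={(1,0),(-1,0)}, with a triangle on one fiber and a square on the other. *)

(* Defs.v *)
From HB Require Import structures.
From mathcomp Require Import all_boot all_order all_algebra finmap.
(* Several notations of mpoly clash with MathComp-Analysis. *)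
From mathcomp Require Import -(notations) mpoly.
From mathcomp Require Import all_classical all_reals all_analysis.
From mathcomp Require Import measurable_realfun complex.

Set Implicit Arguments.
Unset Strict Implicit.
Unset Printing Implicit Defensive.

Import Order.TTheory GRing.Theory Num.Theory.
Import numFieldNormedType.Exports ComplexField.Normc.

Local Open Scope classical_set_scope.
Local Open Scope ring_scope.
Local Open Scope complex_scope.

(* m1 \x m2, carried over to (n+1)-tuples along (x, v) |-> x :: v. *)
Section cons_measure.
Context d (T : measurableType d) (R : realType) (n : nat).
Variable m1 : {sigma_finite_measure set T -> \bar R}.
Variable m2 : {sigma_finite_measure set (n.-tuple T) -> \bar R}.

Let cons_pair (p : T * n.-tuple T) : n.+1.-tuple T := [tuple of p.1 :: p.2].

Definition cons_measure : set (n.+1.-tuple T) -> \bar R :=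
  pushforward (m1 \x m2)%E cons_pair.

Let mf : measurable_fun setT cons_pair.
Proof. exact: measurable_cons. Qed.

Let cons_measure0 : cons_measure set0 = 0%E.
Proof. by rewrite /cons_measure /pushforward preimage_set0 measure0. Qed.

Let cons_measure_ge0 A : (0 <= cons_measure A)%E.
Proof. exact: measure_ge0. Qed.

Let cons_measure_sigma_additive : semi_sigma_additive cons_measure.
Proof.
move=> F mF tF mUF; rewrite /cons_measure /pushforward preimage_bigcup.
apply: measure_semi_sigma_additive.
- by move=> k; rewrite -[X in measurable X]setTI; exact: mf.
- apply/trivIsetP => /= i j _ _ ij; rewrite -preimage_setI.
  by move/trivIsetP : tF => /(_ _ _ _ _ ij) ->//; rewrite preimage_set0.
- by rewrite -preimage_bigcup -[X in measurable X]setTI; exact: mf.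
Qed.

HB.instance Definition _ := isMeasure.Build _ _ _ cons_measure
  cons_measure0 cons_measure_ge0 cons_measure_sigma_additive.

Let cons_measure_sigma_finite : sigma_finite setT cons_measure.
Proof.
have /sigma_finiteP[F [TF ndF Foo]] := sigma_finiteT m1.
have /sigma_finiteP[G [TG ndG Goo]] := sigma_finiteT m2.
exists (fun k => [set v | F k (thead v) /\ G k [tuple of behead v]]).
  apply/esym/seteqP; split => // v _.
  have [i _ Fi] : (\bigcup_i F i) (thead v) by rewrite -TF.
  have [j _ Gj] : (\bigcup_j G j) [tuple of behead v] by rewrite -TG.
  exists (maxn i j) => //; split.
    by move: Fi; exact/subsetPset/ndF/leq_maxl.
  by move: Gj; exact/subsetPset/ndG/leq_maxr.
move=> k; have [mF Fk] := Foo k; have [mG Gk] := Goo k; split.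
  apply: measurableI.
    rewrite -[X in measurable X]setTI.
    exact: (@measurable_tnth _ T n.+1 ord0).
  rewrite -[X in measurable X]setTI.
  exact: (@measurable_behead _ T n).
rewrite /cons_measure /pushforward.
rewrite (_ : _ @^-1` _ = F k `*` G k); last first.
  apply/seteqP; split => -[x v] /=; rewrite theadE;
    by rewrite (_ : [tuple of _] = v) //; exact/val_inj.
by rewrite product_measure1E// lte_mul_pinfty// ge0_fin_numE.
Qed.

HB.instance Definition _ := Measure_isSigmaFinite.Build _ _ _ cons_measure
  cons_measure_sigma_finite.

End cons_measure.

Fixpoint power_measure d (T : measurableType d) (R : realType)
    (m : {sigma_finite_measure set T -> \bar R}) (n : nat) :
    {sigma_finite_measure set (n.-tuple T) -> \bar R} :=
  if n is k.+1 then cons_measure m (power_measure m k)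
  else @dirac _ (0.-tuple T) [tuple] R.

Section sphere.
Variable R : realType.

(* R^n; the sigma-algebra on tuples is generated by the coordinate maps, so
   it is the Borel one. *)
Local Notation euclidean n := (n.-tuple (measurableTypeR R)).

Definition lebesgue_tuple n : {sigma_finite_measure set (euclidean n) -> \bar R} :=
  power_measure (@lebesgue_measure R) n.

Definition enorm n (x : euclidean n) : R :=
  Num.sqrt (\sum_(i < n) (tnth x i : R) ^+ 2).

Definition sphere d : set (euclidean d.+1) := [set x | enorm x = 1].

Definition normalize n (x : euclidean n) : euclidean n :=
  [tuple (tnth x i : R) / enorm x | i < n].

Definition punctured_ball n : set (euclidean n) := [set x | 0 < enorm x <= 1].

Lemma measurable_enorm n : measurable_fun setT (@enorm n : euclidean n -> R).
Proof.
have msqrt : measurable_fun setT (@Num.sqrt R).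
  apply: continuous_measurable_fun.
  exact: sqrt_continuous.
apply: (measurableT_comp msqrt).
apply: (@measurable_sum _ _ R setT _ _
  (fun i (x : euclidean n) => (tnth x i : R) ^+ 2)) => i.
apply: measurable_funX.
exact: (@measurable_tnth _ (measurableTypeR R) n i).
Qed.

Lemma measurable_punctured_ball n : measurable (@punctured_ball n).
Proof.
rewrite (_ : @punctured_ball n = (@enorm n) @^-1` `]0, 1]).
  by rewrite -[X in measurable X]setTI; exact: measurable_enorm.
by apply/seteqP; split => x /=; rewrite in_itv.
Qed.

Lemma measurable_normalize n : measurable_fun setT (@normalize n).
Proof.
apply/measurable_fun_tnthP => i.
rewrite (_ : _ \o _ =
    (fun x : euclidean n => (tnth x i : R) * (enorm x `^ (-1)))); last first.
  apply/funext => x /=.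
  by rewrite tnth_mktuple powR_inv1 // sqrtr_ge0.
apply: measurable_funM.
  exact: (@measurable_tnth _ (measurableTypeR R) n i).
apply: (@measurableT_comp _ _ _ _ _ _ (fun r : R => r `^ (-1))).
  exact: measurable_powR.
exact: measurable_enorm.
Qed.

(* The spherical (surface) measure of S^d, extended by zero to R^(d+1):
   mu(A) = (d+1) * lambda({x | 0 < |x| <= 1, x/|x| in A}), i.e. the measure for
   which lambda disintegrates in polar coordinates as r^d dr (x) mu. *)
Definition sphere_measure d : set (euclidean d.+1) -> \bar R := fun A =>
  ((d.+1%:R)%:E *
   lebesgue_tuple d.+1 (@normalize d.+1 @^-1` A `&` @punctured_ball d.+1))%E.

Section sphere_measure_is_measure.
Variable d : nat.

Let mu : {measure set (euclidean d.+1) -> \bar R} :=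
  mscale (d.+1%:R)%:nng
    (measure_function_pushforward__canonical__measure_function_Measure
      (mrestr (lebesgue_tuple d.+1) (@measurable_punctured_ball d.+1))
      (@measurable_normalize d.+1)).

Let sphere_measureE : @sphere_measure d = mu.
Proof. by []. Qed.

Let sphere_measure0 : @sphere_measure d set0 = 0%E.
Proof. by rewrite sphere_measureE measure0. Qed.

Let sphere_measure_ge0 A : (0 <= @sphere_measure d A)%E.
Proof. by rewrite sphere_measureE measure_ge0. Qed.

Let sphere_measure_sigma_additive : semi_sigma_additive (@sphere_measure d).
Proof. by rewrite sphere_measureE; exact: measure_semi_sigma_additive. Qed.

HB.instance Definition _ := isMeasure.Build _ _ _ (@sphere_measure d)
  sphere_measure0 sphere_measure_ge0 sphere_measure_sigma_additive.

End sphere_measure_is_measure.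

Definition polyfun n (p : mpoly.mpoly n R[i]) (x : euclidean n) : R[i] :=
  mpoly.meval (fun i => (tnth x i : R)%:C) p.

Definition cintegral d (f : euclidean d.+1 -> R[i]) : R[i] :=
  (\int[@sphere_measure d]_(x in @sphere d) complex.Re (f x)) +i*
  (\int[@sphere_measure d]_(x in @sphere d) complex.Im (f x)).

Definition sphere_area d : R := fine (@sphere_measure d (@sphere d)).

(* [mpoly.msize p] is one more than the total degree of p (and 0 if p = 0).
   The empty set is not a design: the identity with p = 1 would read 0 = 1. *)
Definition is_design d (t : nat) (X : {fset euclidean d.+1}) : Prop :=
  (forall x, x \in X -> @sphere d x) /\
  (forall p : mpoly.mpoly d.+1 R[i], (mpoly.msize p <= t.+1)%N ->
     (#|` X|%:R)^-1 * \sum_(x <- X) polyfun p x =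
     (sphere_area d)%:C^-1 * cintegral (@polyfun d.+1 p)).

(* The identifications C = R^2, R x C = R^3 and C^2 = R^4. *)
Definition of_C (z : R[i]) : euclidean 2 := [tuple complex.Re z; complex.Im z].

Definition of_RxC (y : R * R[i]) : euclidean 3 :=
  [tuple y.1; complex.Re y.2; complex.Im y.2].

Definition of_CxC (x : R[i] * R[i]) : euclidean 4 :=
  [tuple complex.Re x.1; complex.Im x.1; complex.Re x.2; complex.Im x.2].

Definition S1_design t (G : {fset R[i]}) : Prop :=
  @is_design 1 t [fset of_C z | z in G]%fset.

Definition S2_design t (Y : {fset R * R[i]}) : Prop :=
  @is_design 2 t [fset of_RxC y | y in Y]%fset.

Definition S3_design t (X : {fset R[i] * R[i]}) : Prop :=
  @is_design 3 t [fset of_CxC x | x in X]%fset.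

Definition S3 : set (R[i] * R[i]) :=
  [set x | normc x.1 ^+ 2 + normc x.2 ^+ 2 = 1].

Definition hopf (x : R[i] * R[i]) : R * R[i] :=
  (normc x.1 ^+ 2 - normc x.2 ^+ 2, 2 * x.1 * x.2).

Definition hopf_fiber (y : R * R[i]) : set (R[i] * R[i]) :=
  [set x | S3 x /\ hopf x = y].

Definition act (x : R[i] * R[i]) (z : R[i]) : R[i] * R[i] :=
  (x.1 * z, x.2 * conjc z).

(* The circle acts on S^3 by isometries preserving each fiber, so this does not
   depend on the base point s. *)
Definition fiber_design t (y : R * R[i]) (G : {fset R[i] * R[i]}) : Prop :=
  exists (s : R[i] * R[i]) (G' : {fset R[i]}),
    [/\ hopf_fiber y s, S1_design t G' & G = [fset act s z | z in G']%fset].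

End sphere.

(* Main.v *)
(** Every polynomial on C^2 is a combination of the monomials
    f = a^i (conj a)^j b^k (conj b)^l. Along a fiber f is a constant times z^(i+l-j-k),
    so its sum over a fiber design vanishes unless i + l = j + k; in that case f is
    constant on the fibers and equal to a polynomial in the Hopf coordinates of degree
    i + l, which is at most t. Averaging over Y gives the mean of this polynomial over
    S^2, which has to be compared with the mean of f over S^3. Both vanish unless i = j
    and k = l, and then both are equal to i! k! / (i + k + 1)!.

    The means come from Gaussian integrals. Lebesgue measure is, in polar coordinates,
    the product of a radial measure and of the spherical measure, so the integral of
    x^m exp(- |x|^2) over R^(d+1), a product of moments in dimension one, is the
    spherical integral of x^m times a constant which depends only on |m|. Integration
    by parts in dimension one then yields (d + e) mean(x_i p) = mean(dp/dx_i) for p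
    homogeneous of degree e. In a complex variable z = x_i + 'i x_j it becomes
    (d + e) mean(z p) = 2 mean(dp/d(conj z)), which determines all the means above. *)

From HB Require Import structures.
Require Import Defs.
From mathcomp Require Import all_boot all_order all_algebra finmap.
From mathcomp Require Import -(notations) mpoly.
From mathcomp Require Import all_classical all_reals all_analysis.
From mathcomp Require Import measurable_realfun complex.
From mathcomp Require Import ring zify.

Set Implicit Arguments.
Unset Strict Implicit.
Unset Printing Implicit Defensive.

Import Order.TTheory GRing.Theory Num.Theory.
Import numFieldNormedType.Exports ComplexField.Normc.

Local Open Scope classical_set_scope.
Local Open Scope ring_scope.

(** * Gaussian moments *)

Section gauss_moment.
Context {R : realType}.
Local Notation mu := (@lebesgue_measure R).

Definition gauss_pow (k : nat) (x : R) : R := x ^+ k * gauss_fun x.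

(** The Taylor term of order [k.+1] of the exponential at [x ^+ 2 / 2] dominates the power
    [2 * k.+1] of [x] up to a constant, hence the power [k] when the norm exceeds 1; the summand 1
    in the constant covers the remaining [x]. *)
Lemma norm_pow_le_expR k (x : R) :
  `|x| ^+ k <= (1 + 2 ^+ k.+1 * k.+1`!%:R) * expR (x ^+ 2 / 2).
Proof.
have y0 : 0 <= x ^+ 2 / 2 by rewrite divr_ge0 ?sqr_ge0.
have h := expR_ge1Dxn k y0.
have e1 : 1 <= expR (x ^+ 2 / 2).
  by apply: le_trans h; rewrite lerDl divr_ge0 ?exprn_ge0.
have e2 : (x ^+ 2) ^+ k.+1 <= 2 ^+ k.+1 * k.+1`!%:R * expR (x ^+ 2 / 2).
  have -> : (x ^+ 2) ^+ k.+1 =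
      2 ^+ k.+1 * k.+1`!%:R * ((x ^+ 2 / 2) ^+ k.+1 / k.+1`!%:R).
    rewrite expr_div_n; field.
    by rewrite pnatr_eq0 -lt0n fact_gt0 expf_neq0.
  rewrite ler_wpM2l ?mulr_ge0// ?exprn_ge0//.
  by apply: le_trans h; rewrite lerDr.
rewrite mulrDl mul1r.
have [x1|x1] := leP `|x| 1.
  apply: (@le_trans _ _ 1); first by rewrite exprn_ile1.
  by rewrite (le_trans e1)// lerDl !mulr_ge0 ?expR_ge0.
apply: (@le_trans _ _ ((x ^+ 2) ^+ k.+1)).
  rewrite -real_normK ?num_real// -exprM.
  by rewrite ler_eXn2l// mul2n -addnn (leq_trans (leqnSn k))// leq_addr.
by rewrite (le_trans e2)// lerDr expR_ge0.
Qed.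

(** Half of the Gaussian exponent absorbs the power; the other half remains as an integrable
    majorant, whose product over the coordinates is again a function of the norm. *)
Lemma gauss_pow_bound k : exists2 C : R, 0 <= C &
  forall x, `|gauss_pow k x| <= C * normal_fun 0 1 x.
Proof.
exists (1 + 2 ^+ k.+1 * k.+1`!%:R); first by rewrite addr_ge0 ?mulr_ge0.
move=> x; rewrite /gauss_pow normrM normrX (ger0_norm (gauss_fun_ge0 _)).
have -> : gauss_fun x = expR (- (x ^+ 2 / 2)) * normal_fun 0 1 x.
  rewrite /gauss_fun /normal_fun -expRD; congr expR.
  by rewrite subr0 expr1n; field.
rewrite mulrA ler_wpM2r ?expR_ge0// expRN ler_pdivrMr ?expR_gt0//.
exact: norm_pow_le_expR.
Qed.

Lemma continuous_gauss_pow k : continuous (gauss_pow k).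
Proof.
move=> x; apply: cvgM; last exact: continuous_gauss_fun.
exact: exprn_continuous.
Qed.

Lemma measurable_gauss_pow k : measurable_fun setT (gauss_pow k).
Proof. apply: continuous_measurable_fun; exact: continuous_gauss_pow. Qed.

Lemma integrable_normal_fun : mu.-integrable setT (EFin \o @normal_fun R 0 1).
Proof.
have p0 : normal_peak (1:R) != 0 by rewrite gt_eqF// normal_peak_gt0// oner_neq0.
have := @integrable_normal_pdf R 0 1.
rewrite (normal_pdfE 0 (oner_neq0 R)) => /(integrableZl measurableT (normal_peak 1)^-1).
by under eq_fun do rewrite -EFinM mulKf//.
Qed.

Lemma integrable_gauss_pow k : mu.-integrable setT (EFin \o gauss_pow k).
Proof.
have [C C0 hC] := gauss_pow_bound k.
have := integrableZl measurableT C integrable_normal_fun.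
apply: le_integrable => //.
  by apply/measurable_EFinP; exact: measurable_gauss_pow.
move=> x _; rewrite /= lee_fin.
by rewrite (le_trans (hC x))// ler_norm.
Qed.

Definition gauss_moment k : R := \int[mu]_x gauss_pow k x.

Lemma gauss_moment0_gt0 : 0 < gauss_moment 0.
Proof.
rewrite /gauss_moment /Rintegral (_ : gauss_pow 0 = gauss_fun); last first.
  by apply/funext => x; rewrite /gauss_pow expr0 mul1r.
by rewrite integralT_gauss/= sqrtr_gt0 pi_gt0.
Qed.

Lemma is_derive_gauss_pow k (x : R) :
  is_derive x 1 (gauss_pow k) (k%:R * gauss_pow k.-1 x - 2 * gauss_pow k.+1 x).
Proof.
have dX n : is_derive x 1 (fun y : R => y ^+ n) (n%:R * x ^+ n.-1).
  rewrite (_ : (fun y : R => y ^+ n) = id ^+ n); last by rewrite exprfctE.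
  apply: is_derive_eq; last by rewrite -[LHS]/(_ * _) mulr1.
have dE : is_derive x 1 (@gauss_fun R) (- (2 * x) * gauss_fun x).
  rewrite (_ : @gauss_fun R = expR \o - (fun y : R => y ^+ 2)); last first.
    by apply/funext.
  have d2 := is_deriveN (dX 2%N).
  have := @is_derive1_comp _ expR (- (fun y : R => y ^+ 2)) x _ _ _ d2.
  move=> /(_ _ (is_derive_expR _)) /is_derive_eq; apply.
  by rewrite /= expr1 mulrC.
rewrite (_ : gauss_pow k = (fun y : R => y ^+ k) * @gauss_fun R); last first.
  by apply/funext.
have := is_deriveM (dX k) dE.
move/is_derive_eq; apply; rewrite -![_ *: _]/(_ * _) /gauss_pow exprSr.
by ring.
Qed.

(** Boundary terms of the integration by parts, with [s] a sign. The bound for the exponent [k.+1]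
    leaves a spare factor [n.+1], so the norm is at most [C * harmonic n]. *)
Lemma gauss_pow_cvg0 k (s : R) : `|s| = 1 ->
  gauss_pow k (s * n.+1%:R) @[n --> \oo] --> (0 : R).
Proof.
move=> s1; have [C C0 hC] := gauss_pow_bound k.+1.
apply: norm_cvg0.
apply: (@squeeze_cvgr _ _ _ _ (fun=> 0) (fun n => C * harmonic n)).
- apply: nearW => n; rewrite normr_ge0/=.
  rewrite -ler_pdivrMr ?invr_gt0// invrK.
  have := hC (s * n.+1%:R).
  rewrite /gauss_pow exprS -mulrA normrM [X in X * _]normrM s1 mul1r.
  rewrite (ger0_norm (ler0n _ _)) mulrC => /le_trans; apply.
  by rewrite ler_piMr// /normal_fun -expR0 ler_expR mulNr oppr_le0 divr_ge0// sqr_ge0.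
- exact: cvg_cst.
- by rewrite -[X in _ --> X](mulr0 C); apply: cvgM; [exact: cvg_cst|exact: cvg_harmonic].
Qed.

(** The difference of the two integrands is the derivative of [gauss_pow k], which vanishes at
    infinity. For [k = 0] the truncated [k.-1] has coefficient 0, and the first moment is found to
    be 0. *)
Lemma gauss_moment_rec k :
  2 * gauss_moment k.+1 = k%:R * gauss_moment k.-1.
Proof.
pose f x := k%:R * gauss_pow k.-1 x - 2 * gauss_pow k.+1 x.
have i1 : mu.-integrable setT (EFin \o (fun x => k%:R * gauss_pow k.-1 x)).
  exact: (integrableZl measurableT (_ : R) (integrable_gauss_pow _)).
have i2 : mu.-integrable setT (EFin \o (fun x => 2 * gauss_pow k.+1 x)).
  exact: (integrableZl measurableT (_ : R) (integrable_gauss_pow _)).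
have fi : mu.-integrable setT (EFin \o f) by exact: (integrableB measurableT i1 i2).
have cf : continuous f.
  move=> x; apply: cvgB; apply: cvgM; [exact: cvg_cst| |exact: cvg_cst|];
    exact: continuous_gauss_pow.
have mf : measurable_fun setT f by exact: continuous_measurable_fun.
suff : \int[mu]_x f x = 0.
  rewrite RintegralB// !RintegralZl//; try exact: integrable_gauss_pow.
  by move/eqP; rewrite subr_eq0 => /eqP.
(* The shift to [n.+1] keeps the interval nondegenerate for [n = 0], as the fundamental theorem of
   calculus requires. *)
pose I (n : nat) := `[- n.+1%:R, n.+1%:R]%classic : set R.
have FTC n : (\int[mu]_(x in I n) (f x)%:E =
    (gauss_pow k n.+1%:R)%:E - (gauss_pow k (- n.+1%:R))%:E)%E.
  apply: continuous_FTC2.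
  - by rewrite (@lt_trans _ _ 0)// ?oppr_lt0.
  - exact: continuous_subspaceT.
  - split.
    + by move=> x _; have [] := is_derive_gauss_pow k x.
    + exact/cvg_at_right_filter/continuous_gauss_pow.
    + exact/cvg_at_left_filter/continuous_gauss_pow.
  - by move=> x _; rewrite derive1E; have [_ ->] := is_derive_gauss_pow k x.
have lim0 : (\int[mu]_(x in I n) (f x)%:E @[n --> \oo] --> 0)%E.
  under eq_fun do rewrite FTC -EFinB.
  apply: cvg_EFin; first exact: nearW.
  rewrite -[X in _ --> X](subr0 0); apply: cvgB.
    under eq_fun do rewrite -[_%:R]mul1r.
    by apply: gauss_pow_cvg0; rewrite normr1.
  under eq_fun do rewrite -mulN1r.
  by apply: gauss_pow_cvg0; rewrite normrN1.
have limf : (\int[mu]_(x in I n) (f x)%:E @[n --> \oo] --> \int[mu]_x (f x)%:E)%E.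
  under eq_fun do rewrite integral_mkcond.
  have [||||| _ _ //] := @dominated_convergence _ _ _ mu setT measurableT
    (fun n => (EFin \o f) \_ (I n)) (EFin \o f) (fun x => `|(f x)%:E|%E).
  - move=> n; apply: (measurable_restrictT _ _).1; first exact: measurable_itv.
    apply: measurable_funTS. exact/measurable_EFinP.
  - exact/measurable_EFinP.
  - apply: aeW => x _; apply: cvg_near_cst.
    (* From this rank on the interval contains [x], so the truncated integrand is constant in
       [n]. *)
    exists (Num.truncn `|x|) => // n /= xn.
    rewrite patchE mem_set// /I/= in_itv/= -ler_norml.
    rewrite (le_trans (ltW (truncnS_gt _)))// ler_nat ltnS//.
  - exact: integrable_abse.
  - apply: aeW => x n _; rewrite patchE; case: ifPn => //= _.
    by rewrite normr0 lee_fin.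
rewrite /Rintegral.
by have -> : (\int[mu]_x (f x)%:E = 0)%E by exact: cvg_unique limf lim0.
Qed.
End gauss_moment.

(** * Power measures *)

Section integral_prod_fun.
Context d1 d2 (T1 : measurableType d1) (T2 : measurableType d2) (R : realType).
Variables (m1 : {sigma_finite_measure set T1 -> \bar R})
          (m2 : {sigma_finite_measure set T2 -> \bar R}).
Variables (g : T1 -> R) (h : T2 -> R).
Hypothesis ig : m1.-integrable setT (EFin \o g).
Hypothesis ih : m2.-integrable setT (EFin \o h).

Lemma integrable_prod_fun :
  (m1 \x m2)%E.-integrable setT (fun p => (g p.1 * h p.2)%:E).
Proof.
have mg := measurable_int _ ig; have mh := measurable_int _ ih.
have mgh : measurable_fun setT (fun p : T1 * T2 => (g p.1 * h p.2)%:E).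
  apply/measurable_EFinP; apply: measurable_funM.
    by apply: (@measurableT_comp _ _ _ _ _ _ g) => //; apply/measurable_EFinP.
  by apply: (@measurableT_comp _ _ _ _ _ _ h) => //; apply/measurable_EFinP.
apply/(integrable12ltyP _ _ mgh).
rewrite (eq_integral (fun x => `|(g x)%:E| * \int[m2]_y `|(h y)%:E|)%E); last first.
  move=> x _; rewrite -ge0_integralZl//; last exact: measurableT_comp.
  by apply: eq_integral => y _; rewrite /= normrM EFinM.
rewrite ge0_integralZr//; last 2 first.
- exact: measurableT_comp.
- exact: integral_ge0.
apply: lte_mul_pinfty => //.
- exact: integral_ge0.
- rewrite ge0_fin_numE ?integral_ge0//; by case/integrableP : ig.
- by case/integrableP : ih.
Qed.

Lemma integral_prod_fun :
  (\int[m1 \x m2]_p (g p.1 * h p.2)%:E =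
   (\int[m1]_x (g x)%:E) * (\int[m2]_y (h y)%:E))%E.
Proof.
rewrite -integral12_prod_meas1; last exact: integrable_prod_fun.
rewrite (eq_integral (fun x => (g x)%:E * \int[m2]_y (h y)%:E)%E); last first.
  move=> x _; rewrite /fubini_F -integralZl//.
rewrite -(fineK (integrable_fin_num _ ih))//.
by rewrite integralZr.
Qed.
End integral_prod_fun.

Section power_measure_theory.
Context d (T : measurableType d) (R : realType).
Variable m : {sigma_finite_measure set T -> \bar R}.

Let cons_pair n (p : T * n.-tuple T) : n.+1.-tuple T := [tuple of p.1 :: p.2].

Let mcons n : measurable_fun setT (@cons_pair n).
Proof. exact: measurable_cons. Qed.

(** Fubini, one coordinate at a time; the base case is the Dirac mass at the empty tuple, where the
    empty product is 1. Integrability is carried along because each use of Fubini needs it for the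
    remaining coordinates. *)
Lemma integral_power_measure n (f : 'I_n -> T -> R) :
  (forall i, m.-integrable setT (EFin \o f i)) ->
  (power_measure m n).-integrable setT
    (fun v => (\prod_(i < n) f i (tnth v i))%:E) /\
  (\int[power_measure m n]_v (\prod_(i < n) f i (tnth v i))%:E =
   (\prod_(i < n) \int[m]_x f i x)%R%:E)%E.
Proof.
elim: n f => [|n IH] f fi.
  have -> : (fun v : 0.-tuple T => (\prod_(i < 0) f i (tnth v i))%:E) = cst 1%:E.
    by apply/funext => v; rewrite big_ord0.
  split; first exact: finite_measure_integrable_cst.
  by rewrite integral_dirac// diracT mul1e big_ord0.
have [ih eh] := IH (fun i => f (lift ord0 i)) (fun i => fi _).
pose F (v : n.+1.-tuple T) := (\prod_(i < n.+1) f i (tnth v i))%:E.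
have FE : F \o @cons_pair n = fun p =>
    (f ord0 p.1 * \prod_(i < n) f (lift ord0 i) (tnth p.2 i))%:E.
  apply/funext => p; rewrite /F/= big_ord_recl tnth0; congr (_ * _)%:E.
  by apply: eq_bigr => i _; rewrite /cons_pair tnthS.
have mF : measurable_fun setT F.
  apply/measurable_EFinP; apply: measurable_prod => i _.
  apply: (@measurableT_comp _ _ _ _ _ _ (f i)); last exact: measurable_tnth.
  by apply/measurable_EFinP; exact: (measurable_int _ (fi i)).
have iF : (m \x power_measure m n)%E.-integrable (@cons_pair n @^-1` setT) (F \o @cons_pair n).
  by rewrite preimage_setT FE; exact: (integrable_prod_fun (fi _) ih).
split.
  exact: (integrable_pushforward (@mcons n) mF iF measurableT).
rewrite [LHS](integral_pushforward (@mcons n) mF iF measurableT).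
rewrite preimage_setT FE; apply: (etrans (integral_prod_fun (fi _) ih)).
rewrite eh big_ord_recl EFinM.
congr (_ * _)%E.
by rewrite /Rintegral (fineK (integrable_fin_num measurableT (fi _))).
Qed.

End power_measure_theory.

(** * Scaling of Lebesgue measure under homotheties *)

Section lebesgue_tuple_scale.
Context {R : realType}.
Local Notation euclidean n := (n.-tuple (measurableTypeR R)).

Definition scale_tuple n (r : R) (x : euclidean n) : euclidean n :=
  [tuple r * (tnth x i : R) | i < n].

Lemma measurable_scale_tuple n r : measurable_fun setT (@scale_tuple n r).
Proof.
apply/measurable_fun_tnthP => i.
rewrite (_ : _ \o _ = (fun x : euclidean n => r * (tnth x i : R))); last first.
  by apply/funext => x /=; rewrite tnth_mktuple.
apply: measurable_funM => //.
exact: (@measurable_tnth _ (measurableTypeR R) n i).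
Qed.

(** Uniqueness of Lebesgue measure: the right-hand side is a measure in [A] with the same values on
    half-open intervals. *)
Lemma lebesgue_measure_scale (r : R) (A : set (measurableTypeR R)) :
  0 < r -> measurable A ->
  lebesgue_measure A = (r%:E * lebesgue_measure (( *%R r) @^-1` A))%E.
Proof.
move=> r0 mA.
have mr : measurable_fun setT ( *%R r : measurableTypeR R -> measurableTypeR R).
  exact: measurable_funM.
pose nr := NngNum (ltW r0).
pose mu : {measure set (measurableTypeR R) -> \bar R} := mscale nr
  (measure_function_pushforward__canonical__measure_function_Measure
     (@lebesgue_measure R) mr).
apply: (@lebesgue_measure_unique R mu) mA => X [[a b] _ <-] /=.
rewrite /mu/= /mscale/= /pushforward.
have -> : *%R r @^-1` `]a, b]%classic = `]a / r, b / r]%classic.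
  apply/seteqP; split => x /=;
    by rewrite !in_itv/= ltr_pdivrMr// ler_pdivlMr// mulrC.
rewrite !lebesgue_measure_itv/= !lte_fin ltr_pM2r ?invr_gt0//.
case: ifPn => _; last by rewrite mule0.
by rewrite -!EFinB -EFinM -mulrBl mulrCA divff ?gt_eqF// mulr1.
Qed.

(** Induction on the dimension: the right-hand side is a measure on the product which, by scaling in
    each factor, agrees with the product measure on rectangles. *)
Lemma lebesgue_tuple_scale n (r : R) (A : set (euclidean n)) :
  0 < r -> measurable A ->
  lebesgue_tuple R n A = ((r ^+ n)%:E * lebesgue_tuple R n (@scale_tuple n r @^-1` A))%E.
Proof.
move=> r0; elim: n A => [|n IH] A mA.
  rewrite mul1e; congr (lebesgue_tuple R 0 _); apply/seteqP.
  by split => x /=; rewrite (tuple0 x) (tuple0 (scale_tuple _ _)).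
pose c (p : measurableTypeR R * euclidean n) : euclidean n.+1 := [tuple of p.1 :: p.2].
pose s (p : measurableTypeR R * euclidean n) : measurableTypeR R * euclidean n :=
  (r * p.1, scale_tuple r p.2).
have mc : measurable_fun setT c by exact: measurable_cons.
have ms : measurable_fun setT s.
  apply/measurable_fun_pairP; split.
    exact: (@measurable_funM _ _ _ _ (cst r) fst).
  exact: (measurableT_comp (@measurable_scale_tuple n r)).
pose nr := NngNum (ltW (exprn_gt0 n.+1 r0)).
pose mu : {measure set (measurableTypeR R * euclidean n) -> \bar R} := mscale nr
  (measure_function_pushforward__canonical__measure_function_Measure
     (lebesgue_measure \x lebesgue_tuple R n)%E ms).
have mcA : measurable (c @^-1` A) by rewrite -[X in measurable X]setTI; exact: mc.
have -> : lebesgue_tuple R n.+1 A = (lebesgue_measure \x lebesgue_tuple R n)%E (c @^-1` A) by [].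
have mu_rect B C : measurable B -> measurable C ->
    mu (B `*` C) = (lebesgue_measure B * lebesgue_tuple R n C)%E.
  move=> mB mC; rewrite /mu/= /mscale/= /pushforward/=.
  have -> : s @^-1` (B `*` C) = ( *%R r @^-1` B) `*` (scale_tuple r @^-1` C).
    by apply/seteqP; split.
  rewrite product_measure1E//; last 2 first.
  - by rewrite -[X in measurable X]setTI; exact: measurable_funM.
  - by rewrite -[X in measurable X]setTI; exact: measurable_scale_tuple.
  rewrite [in RHS](lebesgue_measure_scale r0 mB) [in RHS](IH _ mC).
  by rewrite exprS EFinM muleACA.
rewrite (product_measure_unique mu_rect mcA).
rewrite /mu/= /mscale/= /pushforward/=; congr (_ * _)%E.
  rewrite /lebesgue_tuple/= /cons_measure /pushforward/=; congr (_ _).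
  apply/seteqP; split=> -[x v] /=; rewrite /c /=;
   (have -> : scale_tuple r [tuple of x :: v] = [tuple of r * x :: scale_tuple r v];
     [by apply: eq_from_tnth => i; rewrite tnth_mktuple;
      case: (unliftP ord0 i) => [j|] ->; rewrite ?tnth0 ?tnthS ?tnth_mktuple|by []]).
Qed.

End lebesgue_tuple_scale.

(** * Polar coordinates *)

Section polar.
Context {R : realType}.
Local Notation euclidean n := (n.-tuple (measurableTypeR R)).

Lemma enorm_ge0 n (x : euclidean n) : 0 <= enorm x.
Proof. exact: sqrtr_ge0. Qed.

Lemma enorm_sqr n (x : euclidean n) :
  enorm x ^+ 2 = \sum_(i < n) (tnth x i : R) ^+ 2.
Proof. by rewrite sqr_sqrtr// sumr_ge0// => i _; exact: sqr_ge0. Qed.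

Lemma norm_tnth_le_enorm n (x : euclidean n) i : `|tnth x i : R| <= enorm x.
Proof.
rewrite -(@ler_pXn2r _ 2)// ?nnegrE ?enorm_ge0//.
rewrite real_normK ?num_real// enorm_sqr (bigD1 i)//= lerDl.
by rewrite sumr_ge0// => j _; exact: sqr_ge0.
Qed.

Lemma enorm_scale n r (x : euclidean n) : 0 <= r ->
  enorm (scale_tuple r x) = r * enorm x.
Proof.
move=> r0; rewrite /enorm; under eq_bigr do rewrite tnth_mktuple exprMn.
by rewrite -mulr_sumr sqrtrM ?sqr_ge0// sqrtr_sqr ger0_norm.
Qed.

Lemma normalize_scale n r (x : euclidean n) : 0 < r ->
  normalize (scale_tuple r x) = normalize x.
Proof.
move=> r0; apply: eq_from_tnth => i; rewrite !tnth_mktuple enorm_scale ?ltW//.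
by rewrite -mulf_div divff ?gt_eqF// mul1r.
Qed.

Lemma enorm_normalize n (x : euclidean n) : 0 < enorm x ->
  enorm (normalize x) = 1.
Proof.
move=> x0; have -> : normalize x = scale_tuple (enorm x)^-1 x.
  by apply: eq_from_tnth => i; rewrite !tnth_mktuple mulrC.
by rewrite enorm_scale ?invr_ge0 ?ltW// mulVf// gt_eqF.
Qed.

Lemma prod_expR_sqr n (c : R) (x : euclidean n) :
  \prod_(i < n) expR (c * (tnth x i : R) ^+ 2) = expR (c * enorm x ^+ 2).
Proof. by rewrite enorm_sqr mulr_sumr expR_sum. Qed.

Lemma measurable_enorm_preimage n (E : set R) :
  measurable E -> measurable (@enorm R n @^-1` E).
Proof.
by move=> mE; rewrite -[X in measurable X]setTI; exact: measurable_enorm.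
Qed.

Lemma measurable_normalize_preimage n (A : set (euclidean n)) :
  measurable A -> measurable (@normalize R n @^-1` A).
Proof.
by move=> mE; rewrite -[X in measurable X]setTI; exact: measurable_normalize.
Qed.

Lemma integrable_gauss_enorm n :
  (lebesgue_tuple R n).-integrable setT (fun x => (gauss_fun (enorm x))%:E) /\
  (\int[lebesgue_tuple R n]_x (gauss_fun (enorm x))%:E = (@gauss_moment R 0 ^+ n)%:E)%E.
Proof.
have [] := @integral_power_measure _ _ R lebesgue_measure n (fun=> gauss_pow 0)
  (fun=> integrable_gauss_pow 0).
have -> : (fun v : euclidean n => (\prod_(i < n) gauss_pow 0 (tnth v i : R))%:E) =
    (fun x => (gauss_fun (enorm x))%:E).
  apply/funext => v; congr EFin.
  rewrite /gauss_fun -mulN1r -prod_expR_sqr; apply: eq_bigr => i _.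
  by rewrite /gauss_pow expr0 mul1r mulN1r.
by rewrite prodr_const card_ord.
Qed.

(** Markov's inequality for the Gaussian, which has a finite integral and is at least
    [expR (- r ^+ 2)] on the ball. *)
Lemma lebesgue_ball_lty n (r : R) :
  (lebesgue_tuple R n (@enorm R n @^-1` `]-oo, r]) < +oo)%E.
Proof.
set B := _ @^-1` _; have mB : measurable B by exact: measurable_enorm_preimage.
pose e := expR (- r ^+ 2); have e0 : 0 < e by exact: expR_gt0.
have [ig eg] := integrable_gauss_enorm n.
have : (e%:E * lebesgue_tuple R n B <= (@gauss_moment R 0 ^+ n)%:E)%E.
  rewrite -eg -(setIT B) -integral_indic// -ge0_integralZl//; last 2 first.
  - by apply/measurable_EFinP.
  - by rewrite lee_fin ltW.
  apply: ge0_le_integral => //.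
  - by move=> x _; rewrite -EFinM lee_fin indicE mulr_ge0 ?ler0n ?(ltW e0).
  - by apply: measurable_funeM; apply/measurable_EFinP.
  - exact: (measurable_int _ ig).
  move=> x _; rewrite lee_fin indicE; case: (boolP (x \in B)) => xB; last first.
    by rewrite mulr0 gauss_fun_ge0.
  rewrite mulr1 ler_expR lerN2.
  have {}xB : enorm x <= r by move: xB; rewrite inE /B/= in_itv.
  by rewrite ler_pXn2r// nnegrE ?enorm_ge0// (le_trans (enorm_ge0 x)).
rewrite -lee_pdivlMl// => /le_lt_trans; apply.
by rewrite -EFinM ltry.
Qed.

(* Doubling fixes this set and multiplies its finite measure by 2^(d+1). *)
Lemma lebesgue_enorm0 d : lebesgue_tuple R d.+1 (@enorm R d.+1 @^-1` `]-oo, 0]) = 0%E.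
Proof.
set Z := _ @^-1` _; have mZ : measurable Z by exact: measurable_enorm_preimage.
have := lebesgue_tuple_scale (@ltr0n R 2) mZ.
have -> : scale_tuple 2 @^-1` Z = Z.
  by apply/seteqP; split => x; rewrite /Z/= !in_itv/= enorm_scale// pmulr_rle0.
have : lebesgue_tuple R d.+1 Z \is a fin_num.
  by rewrite ge0_fin_numE// lebesgue_ball_lty.
case: (lebesgue_tuple R d.+1 Z) => // z _; rewrite -EFinM => -[] /eqP.
rewrite -subr_eq0 -{1}(mul1r z) -mulrBl mulf_eq0 => /orP[|/eqP->//].
by rewrite subr_eq0 lt_eqF// exprn_egt1// ltr1n.
Qed.

(** Bounding the norm through the preimage of a ray makes this family stable under homotheties and
    fits the generating family [rays]. The origin is not excluded, in contrast with
    [punctured_ball]. *)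
Definition truncated_cone n (A : set (euclidean n)) (r : R) : set (euclidean n) :=
  @normalize R n @^-1` A `&` @enorm R n @^-1` `]-oo, r].

Lemma measurable_truncated_cone n (A : set (euclidean n)) r :
  measurable A -> measurable (truncated_cone A r).
Proof.
move=> mA; apply: measurableI; first exact: measurable_normalize_preimage.
exact: measurable_enorm_preimage.
Qed.

(** The truncated cone and the set in the definition differ only within the set of norm 0, which is
    null. *)
Lemma sphere_measureE d (A : set (euclidean d.+1)) : measurable A ->
  sphere_measure A = ((d.+1%:R)%:E * lebesgue_tuple R d.+1 (truncated_cone A 1))%E.
Proof.
move=> mA; rewrite /sphere_measure; congr (_ * _)%E.
set X := _ @^-1` A.
have mX : measurable X by exact: measurable_normalize_preimage.
have -> : truncated_cone A 1 =
    (X `&` @punctured_ball R d.+1) `|` (X `&` @enorm R d.+1 @^-1` `]-oo, 0]).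
  apply/seteqP; split => x /=; rewrite /truncated_cone /punctured_ball/= !in_itv/=.
    by move=> [Xx ->]; have [|] := leP (enorm x) 0; [right|left].
  by case=> -[Xx]; [case/andP=> _ ->|move=> /le_trans ->].
rewrite measureU0//.
- by apply: measurableI => //; exact: measurable_punctured_ball.
- by apply: measurableI => //; exact: measurable_enorm_preimage.
- apply: (@subset_measure0 _ _ _ _ _ (@enorm R d.+1 @^-1` `]-oo, 0])) => //.
  + by apply: measurableI => //; exact: measurable_enorm_preimage.
  + exact: measurable_enorm_preimage.
  + exact: lebesgue_enorm0.
Qed.

(** Positive dilations preserve the normalization, so cones scale like the whole space; [r = 0] is
    covered by [lebesgue_enorm0]. *)
Lemma lebesgue_cone_scale d (A : set (euclidean d.+1)) (r : R) :
  0 <= r -> measurable A ->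
  lebesgue_tuple R d.+1 (truncated_cone A r) =
  ((r ^+ d.+1)%:E * lebesgue_tuple R d.+1 (truncated_cone A 1))%E.
Proof.
rewrite le_eqVlt => /predU1P[<- mA|r0 mA].
  rewrite expr0n mul0e.
  apply: (@subset_measure0 _ _ _ _ _ (@enorm R d.+1 @^-1` `]-oo, 0])) => //.
  + exact: measurable_truncated_cone.
  + exact: measurable_enorm_preimage.
  + exact: subIsetr.
  + exact: lebesgue_enorm0.
rewrite (lebesgue_tuple_scale r0); last exact: measurable_truncated_cone.
congr (_ * lebesgue_tuple R d.+1 _)%E; rewrite /truncated_cone.
apply/seteqP; split => x /=;
  by rewrite normalize_scale// !in_itv/= enorm_scale ?(ltW r0)// ger_pMr.
Qed.

(** This is r^d dr times the area of the sphere. Identities in polar coordinates therefore carry a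
    compensating factor [area] on the side of Lebesgue measure. *)
Definition radial_measure d : set R -> \bar R :=
  pushforward (lebesgue_tuple R d.+1) (@enorm R d.+1).

Section radial_measure_is_measure.
Variable d : nat.

Let mu : {measure set R -> \bar R} :=
  measure_function_pushforward__canonical__measure_function_Measure
    (lebesgue_tuple R d.+1) (@measurable_enorm R d.+1).

Let radial_measure0 : @radial_measure d set0 = 0%E.
Proof. exact: (measure0 mu). Qed.

Let radial_measure_ge0 A : (0 <= @radial_measure d A)%E.
Proof. exact: (measure_ge0 mu). Qed.

Let radial_measure_sigma_additive : semi_sigma_additive (@radial_measure d).
Proof. exact: (@measure_semi_sigma_additive _ _ _ mu). Qed.

HB.instance Definition _ := isMeasure.Build _ _ _ (@radial_measure d)
  radial_measure0 radial_measure_ge0 radial_measure_sigma_additive.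

End radial_measure_is_measure.

Let radial_sigma_finite d : sigma_finite setT (@radial_measure d).
Proof.
exists (fun k => `]-oo, k%:R]%classic).
  apply/esym/seteqP; split => // x _.
  exists (Num.truncn `|x|).+1 => //=; rewrite in_itv/=.
  by rewrite (le_trans (ler_norm x))// ltW// truncnS_gt.
move=> k; split; first exact: measurable_itv.
exact: lebesgue_ball_lty.
Qed.

HB.instance Definition _ d := Measure_isSigmaFinite.Build _ _ _
  (@radial_measure d) (@radial_sigma_finite d).

Let sphere_fin d : fin_num_fun (@sphere_measure R d).
Proof.
move=> A mA; rewrite sphere_measureE// ge0_fin_numE; last exact: mule_ge0.
rewrite lte_mul_pinfty// (@le_lt_trans _ _ (lebesgue_tuple R d.+1 (@enorm R d.+1 @^-1` `]-oo, 1%R])))//.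
  apply: le_measure; rewrite ?inE; [exact: measurable_truncated_cone|exact: measurable_enorm_preimage|].
  exact: subIsetr.
exact: lebesgue_ball_lty.
Qed.

HB.instance Definition _ d := Measure_isFinite.Build _ _ _
  (@sphere_measure R d) (@sphere_fin d).

End polar.

Lemma integral_mscale d (T : measurableType d) (R : realType)
    (m : {measure set T -> \bar R}) (k : {nonneg R}) (f : T -> \bar R) :
  m.-integrable setT f ->
  (\int[mscale k m]_x f x = k%:num%:E * \int[m]_x f x)%E.
Proof.
move=> mf; have fm := measurable_int _ mf.
have -> : (\int[m]_x f x = \int[m]_x f^\+ x - \int[m]_x f^\- x)%E by exact: integralE.
rewrite [LHS]integralE !ge0_integral_mscale//; last 2 first.
- exact: measurable_funeneg.
- exact: measurable_funepos.
rewrite [RHS]muleBr// fin_num_adde_defl// fin_numN.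
exact: (integrable_fin_num measurableT (integrable_funeneg measurableT mf)).
Qed.

Section rays.
Context {R : realType}.

(** A pi-system generating the Borel sets of the line, on which radial measures are known: the
    preimages of rays under the norm are balls. *)
Definition rays : set (set R) := [set `]-oo, r]%classic | r in setT].

Lemma measurable_rays : measurable = <<s rays >> :> set (set R).
Proof.
apply/seteqP; split.
  apply: smallest_sub; first exact: smallest_sigma_algebra.
  move=> _ [[a b] _ <-].
  have -> : `]a, b]%classic = `]-oo, b] `\` `]-oo, a] :> set R.
    apply/seteqP; split => x /=; rewrite !in_itv/=.
      by move=> /andP[ax xb]; split => //; apply/negP; rewrite -ltNge.
    by move=> [-> /negP]; rewrite -ltNge => ->.
  apply: (@measurableD _ (g_sigma_algebraType rays)).
    by apply: sub_sigma_algebra; exists b.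
  by apply: sub_sigma_algebra; exists a.
apply: smallest_sub; first exact: sigma_algebra_measurable.
by move=> _ [r _ <-]; exact: measurable_itv.
Qed.

Lemma setI_closed_rays : setI_closed rays.
Proof.
move=> _ _ [r _ <-] [s _ <-]; exists (Num.min r s) => //.
by apply/seteqP; split => x /=; rewrite !in_itv/= le_min => /andP.
Qed.

Lemma bigcup_rays : \bigcup_k `]-oo, k%:R]%classic = [set: R].
Proof.
apply/seteqP; split => // x _.
exists (Num.truncn `|x|).+1 => //=; rewrite in_itv/=.
by rewrite (le_trans (ler_norm x))// ltW// truncnS_gt.
Qed.

End rays.

Section polar_measure.
Context {R : realType} (d : nat).
Local Notation euclidean n := (n.-tuple (measurableTypeR R)).
Local Notation lambda := (lebesgue_tuple R d.+1).
Local Notation sigma := (@sphere_measure R d).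
Local Notation area := (fine (sigma setT)).

Lemma sphere_measure_fin (A : set (euclidean d.+1)) :
  measurable A -> sigma A = (fine (sigma A))%:E.
Proof. by move=> mA; rewrite fineK// fin_num_measure. Qed.

(** For fixed [A] both sides are measures in [E], so rays suffice. Over a ray both scale by the
    power [d.+1] of the radius, and at radius 1 the claim is the symmetry of a product of two cone
    measures. *)
Lemma lebesgue_polar_rect (E : set R) (A : set (euclidean d.+1)) :
  measurable E -> measurable A ->
  (area%:E * lambda (@normalize R d.+1 @^-1` A `&` @enorm R d.+1 @^-1` E) =
  @radial_measure R d E * sigma A)%E.
Proof.
move=> mE mA.
have mnA : measurable (@normalize R d.+1 @^-1` A) by exact: measurable_normalize_preimage.
pose mu1 : {measure set R -> \bar R} := mscale (NngNum (fine_ge0 (measure_ge0 sigma setT)))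
  (measure_function_pushforward__canonical__measure_function_Measure
    (mrestr lambda mnA) (@measurable_enorm R d.+1)).
pose mu2 : {measure set R -> \bar R} :=
  mscale (NngNum (fine_ge0 (measure_ge0 sigma A))) (@radial_measure R d).
have eA := sphere_measure_fin mA; have eT := sphere_measure_fin measurableT.
rewrite eA [RHS]muleC setIC.
apply: (@measure_unique _ R _ rays (fun k => `]-oo, k%:R]%classic) measurable_rays
  setI_closed_rays _ bigcup_rays mu1 mu2) mE.
- by move=> k; exists k%:R.
- move=> _ [r _ <-]; change (area%:E * lambda (@enorm R d.+1 @^-1` `]-oo, r] `&` @normalize R d.+1 @^-1` A) =
    (fine (sigma A))%:E * lambda (@enorm R d.+1 @^-1` `]-oo, r]))%E.
  have -> : @enorm R d.+1 @^-1` `]-oo, r] = truncated_cone setT r.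
    by rewrite /truncated_cone preimage_setT setTI.
  have -> : truncated_cone setT r `&` @normalize R d.+1 @^-1` A = truncated_cone A r.
    by rewrite /truncated_cone preimage_setT setTI setIC.
  have [r0|r0] := leP 0 r.
    rewrite -eA -eT (sphere_measureE mA) (sphere_measureE measurableT).
    rewrite (lebesgue_cone_scale r0 mA) (lebesgue_cone_scale r0 measurableT).
    move: (lambda (truncated_cone A 1)) (lambda (truncated_cone setT 1)) => u v.
    by rewrite muleACA [RHS]muleACA; congr (_ * _)%E; exact: muleC.
  have h (B : set (euclidean d.+1)) : truncated_cone B r = set0.
    apply/seteqP; split => // x [_]; rewrite /= in_itv/= => xr.
    by have := enorm_ge0 x; rewrite leNgt (le_lt_trans xr).
  by rewrite (h A) (h setT) measure0 !mule0.
- move=> k.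
  change (area%:E * lambda (@enorm R d.+1 @^-1` `]-oo, k%:R%R] `&` @normalize R d.+1 @^-1` A) < +oo)%E.
  rewrite lte_mul_pinfty ?lee_fin ?fine_ge0//.
  apply: (@le_lt_trans _ _ (lambda (@enorm R d.+1 @^-1` `]-oo, k%:R]))).
    apply: le_measure; rewrite ?inE; last exact: subIsetl.
      apply: measurableI => //; exact: measurable_enorm_preimage.
    exact: measurable_enorm_preimage.
  exact: lebesgue_ball_lty.
Qed.

Definition polar (x : euclidean d.+1) : R * euclidean d.+1 := (enorm x, normalize x).

Lemma measurable_polar : measurable_fun setT polar.
Proof.
apply/measurable_fun_pairP; split; [exact: measurable_enorm|exact: measurable_normalize].
Qed.

(** Rectangles determine a product of sigma-finite measures, so [lebesgue_polar_rect] settles all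
    measurable sets. *)
Lemma lebesgue_polarE (X : set (R * euclidean d.+1)) : measurable X ->
  ((@radial_measure R d \x sigma)%E X = area%:E * lambda (polar @^-1` X))%E.
Proof.
move=> mX.
pose mu : {measure set (R * euclidean d.+1) -> \bar R} :=
  mscale (NngNum (fine_ge0 (measure_ge0 sigma setT)))
  (measure_function_pushforward__canonical__measure_function_Measure
    lambda measurable_polar).
have mu_rect E A : measurable E -> measurable A ->
    mu (E `*` A) = (@radial_measure R d E * sigma A)%E.
  move=> mE mA; rewrite -lebesgue_polar_rect// /mu/= /mscale/= /pushforward.
  by congr (_ * lambda _)%E; rewrite setIC; apply/seteqP; split.
by rewrite (product_measure_unique mu_rect mX).
Qed.

Lemma integral_polar (g : R -> R) (h : euclidean d.+1 -> R) :
  (@radial_measure R d).-integrable setT (EFin \o g) ->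
  sigma.-integrable setT (EFin \o h) ->
  lambda.-integrable setT (fun x => (g (enorm x) * h (normalize x))%:E) ->
  ((\int[@radial_measure R d]_r (g r)%:E) * \int[sigma]_u (h u)%:E =
   area%:E * \int[lambda]_x (g (enorm x) * h (normalize x))%:E)%E.
Proof.
move=> ig ih igh; rewrite -integral_prod_fun//.
pose F (p : R * euclidean d.+1) := (g p.1 * h p.2)%:E.
have mF : measurable_fun setT F by exact: (measurable_int _ (integrable_prod_fun ig ih)).
have iF : lambda.-integrable (polar @^-1` setT) (F \o polar) by rewrite preimage_setT.
pose nu : {measure set (R * euclidean d.+1) -> \bar R} :=
  measure_function_pushforward__canonical__measure_function_Measure
    lambda measurable_polar.
pose mu : {measure set (R * euclidean d.+1) -> \bar R} :=
  mscale (NngNum (fine_ge0 (measure_ge0 sigma setT))) nu.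
transitivity (\int[mu]_p F p)%E.
  by apply: eq_measure_integral => X mX _; exact: lebesgue_polarE.
have inu : nu.-integrable setT F by exact: (integrable_pushforward measurable_polar mF iF measurableT).
rewrite integral_mscale//; congr (_ * _)%E.
by rewrite [LHS](integral_pushforward measurable_polar mF iF measurableT) preimage_setT.
Qed.

Lemma measurable_sphere : measurable (@sphere R d).
Proof.
rewrite (_ : @sphere R d = @enorm R d.+1 @^-1` [set 1]).
  exact: measurable_enorm_preimage.
by apply/seteqP; split.
Qed.

Definition monomial (a : 'I_d.+1 -> nat) (x : euclidean d.+1) : R :=
  \prod_i (tnth x i : R) ^+ a i.

Lemma measurable_monomial a : measurable_fun setT (monomial a).
Proof.
apply: measurable_prod => i _; apply: measurable_funX.
exact: (@measurable_tnth _ (measurableTypeR R) _ i).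
Qed.

Lemma monomial_le1 a x : @sphere R d x -> `|monomial a x| <= 1.
Proof.
move=> Sx; rewrite normr_prod; apply: prodr_ile1 => i _.
rewrite normr_ge0 normrX exprn_ile1//.
by rewrite (le_trans (norm_tnth_le_enorm x i))// Sx.
Qed.

Lemma integrable_monomial a : sigma.-integrable (@sphere R d) (EFin \o monomial a).
Proof.
apply: measurable_bounded_integrable.
- exact: measurable_sphere.
- by rewrite -ge0_fin_numE// fin_num_measure//; exact: measurable_sphere.
- by apply: measurable_funTS; exact: measurable_monomial.
- exists 1; split => // M M1 x Sx /=.
  by rewrite (le_trans (monomial_le1 a Sx))// ltW.
Qed.

Definition sphere_moment a : R := \int[sigma]_(x in @sphere R d) monomial a x.

Definition radial_moment k : R := \int[@radial_measure R d]_r gauss_pow k r.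

Lemma integrable_gauss_pow_enorm k :
  lambda.-integrable setT (EFin \o (gauss_pow k \o @enorm R d.+1)).
Proof.
have [C C0 hC] := @gauss_pow_bound R k.
have [+ _] := @integral_power_measure _ _ R lebesgue_measure d.+1 (fun=> normal_fun 0 1)
  (fun=> integrable_normal_fun).
move=> /(integrableZl measurableT C).
apply: le_integrable => //.
  apply/measurable_EFinP; apply: measurableT_comp; first exact: measurable_gauss_pow.
  exact: measurable_enorm.
move=> x _; rewrite /= lee_fin (le_trans (hC _))//.
rewrite (le_trans _ (ler_norm _))//.
have e (y : R) : normal_fun 0 1 y = expR (- 2^-1 * y ^+ 2).
  by rewrite /normal_fun subr0 expr1n; congr expR; field.
by rewrite (eq_bigr _ (fun i _ => e _)) prod_expR_sqr e.
Qed.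

Lemma integrable_radial k : (@radial_measure R d).-integrable setT (EFin \o gauss_pow k).
Proof.
apply: (integrable_pushforward (@measurable_enorm R d.+1)) => //.
  by apply/measurable_EFinP; exact: measurable_gauss_pow.
by rewrite preimage_setT; exact: integrable_gauss_pow_enorm.
Qed.

(* Integrate x^a exp(- |x|^2) over R^(d+1) in polar and in Cartesian coordinates. *)
Lemma radial_sphere_moment a :
  radial_moment (\sum_i a i) * sphere_moment a =
  area * \prod_i gauss_moment (a i).
Proof.
set k := (\sum_i a i)%N.
(* Extension by zero off the sphere makes the monomial bounded, so that [integral_polar] applies on
   the whole space. *)
pose h := monomial a \_ (@sphere R d).
have hE : EFin \o h = (EFin \o monomial a) \_ (@sphere R d).
  by rewrite -restrict_EFin.
have mS := measurable_sphere.
have ih : sigma.-integrable setT (EFin \o h).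
  by rewrite hE; apply: (iffLR (integrable_mkcond _ mS)); exact: integrable_monomial.
have mh : measurable_fun setT h by apply/measurable_EFinP; exact: (measurable_int _ ih).
have h1 x : `|h x| <= 1.
  by rewrite /h patchE; case: ifPn; [rewrite inE => /monomial_le1|rewrite normr0].
have igh : lambda.-integrable setT (fun x => (gauss_pow k (enorm x) * h (normalize x))%:E).
  have := integrable_gauss_pow_enorm k; apply: le_integrable => //.
    apply/measurable_EFinP; apply: measurable_funM.
      apply: measurableT_comp; first exact: measurable_gauss_pow.
      exact: measurable_enorm.
    by apply: measurableT_comp => //; exact: measurable_normalize.
  by move=> x _; rewrite /= lee_fin normrM ler_piMr.
have := integral_polar (integrable_radial k) ih igh.
have -> : (\int[sigma]_u (h u)%:E = (sphere_moment a)%:E)%E.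
  rewrite /sphere_moment /Rintegral (fineK (integrable_fin_num mS (integrable_monomial a))).
  by rewrite integral_mkcond -hE.
have -> : (\int[@radial_measure R d]_r (gauss_pow k r)%:E = (radial_moment k)%:E)%E.
  by rewrite /radial_moment /Rintegral (fineK (integrable_fin_num measurableT (integrable_radial k))).
have [ip ep] := @integral_power_measure _ _ R lebesgue_measure d.+1
  (fun i => gauss_pow (a i)) (fun i => integrable_gauss_pow (a i)).
have -> : (\int[lambda]_x (gauss_pow k (enorm x) * h (normalize x))%:E =
    (\prod_i gauss_moment (a i))%:E)%E.
  rewrite -ep; apply: ae_eq_integral => //.
  - exact: (measurable_int _ igh).
  - exact: (measurable_int _ ip).
  (* Off the origin x^a is |x|^k times the monomial at x/|x|, so the integrands agree; the origin
     itself is not normalized to a point of the sphere. *)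
  exists (@enorm R d.+1 @^-1` `]-oo, 0]); split.
  - exact: measurable_enorm_preimage.
  - exact: lebesgue_enorm0.
  move=> x /= /not_implyP[_ xh]; rewrite in_itv/= leNgt; apply/negP => x0; apply: xh.
  congr EFin; rewrite /h patchE mem_set; last exact: enorm_normalize.
  rewrite /gauss_pow /monomial big_split/= -(mulrC (gauss_fun _)) -mulrA mulrC.
  congr (_ * _); last first.
    rewrite /gauss_fun -mulN1r -prod_expR_sqr; apply: eq_bigr => i _.
    by rewrite mulN1r.
  under eq_bigr do rewrite tnth_mktuple expr_div_n.
  rewrite big_split/= mulrCA prodfV/= -expr_sum divff ?mulr1//.
  by rewrite expf_neq0// gt_eqF.
by rewrite -!EFinM => -[].
Qed.
End polar_measure.

(** * Moments of the sphere *)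

Section sphere_moment_rec.
Context {R : realType} (d : nat).
Local Notation euclidean n := (n.-tuple (measurableTypeR R)).
Local Notation lambda := (lebesgue_tuple R d.+1).
Local Notation sigma := (@sphere_measure R d).
Local Notation area := (fine (sigma setT)).

(** Otherwise the Gaussian integral, a power of the positive number [gauss_moment 0], would
    vanish. *)
Lemma lebesgue_tupleT_neq0 : lambda setT != 0%E.
Proof.
apply/eqP => l0; have [ig eg] := @integrable_gauss_enorm R d.+1.
have : (\int[lambda]_x (gauss_fun (enorm x))%:E = 0)%E.
  by apply: null_set_integral => //; exact: (measurable_int _ ig).
move=> /eqP; rewrite eg eqe expf_eq0/=.
by rewrite gt_eqF// gauss_moment0_gt0.
Qed.

(** If the area were 0, the unit ball would be null, then every ball by scaling, hence the whole
    space. *)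
Lemma sphere_area_gt0 : 0 < area.
Proof.
rewrite lt_neqAle fine_ge0// andbT eq_sym; apply/eqP => a0.
have s0 : sigma setT = 0%E by rewrite sphere_measure_fin// a0.
have c0 : lambda (truncated_cone setT 1) = 0%E.
  by move: s0; rewrite sphere_measureE// => /eqP; rewrite mule_eq0 eqe pnatr_eq0 => /eqP.
have /eqP := lebesgue_tupleT_neq0; apply.
have r0 (A : set R) : measurable A -> @radial_measure R d A = mzero A.
  move=> mA; apply: (measure_unique rays (fun k => `]-oo, k%:R]%classic) measurable_rays
    setI_closed_rays _ bigcup_rays) mA.
  - by move=> k; exists k%:R.
  - move=> _ [r _ <-]; change (lambda (@enorm R d.+1 @^-1` `]-oo, r]) = 0%E).
    have -> : @enorm R d.+1 @^-1` `]-oo, r] = truncated_cone setT r.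
      by rewrite /truncated_cone preimage_setT setTI.
    have [rge0|rlt0] := leP 0 r; first by rewrite lebesgue_cone_scale// c0 mule0.
    apply: (@subset_measure0 _ _ _ _ _ (@enorm R d.+1 @^-1` `]-oo, 0])) => //.
    + exact: measurable_truncated_cone.
    + exact: measurable_enorm_preimage.
    + by move=> x [_]; rewrite /= !in_itv/= => /le_trans; apply; exact: ltW.
    + exact: lebesgue_enorm0.
  - by move=> k; exact: lebesgue_ball_lty.
exact: (r0 setT measurableT).
Qed.

(** Off the origin every normalized point is on the sphere, so no mass lies elsewhere. *)
Lemma sphere_areaE : sphere_area R d = area.
Proof.
congr fine; rewrite /sphere_measure preimage_setT setTI; congr (_ * lambda _)%E.
apply/seteqP; split => x; first by case.
by move=> xb; split => //; apply: enorm_normalize; move: xb => /andP[].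
Qed.

(** On norms the integrand is nonnegative, and it is positive off the origin, which is null; a zero
    integral would make the whole space null. *)
Lemma radial_moment_neq0 k : radial_moment (R := R) d k != 0.
Proof.
have ig := @integrable_gauss_pow_enorm R d k.
apply/eqP => c0; have /eqP := lebesgue_tupleT_neq0; apply.
have : (\int[lambda]_x `|(gauss_pow k (enorm x))%:E| = 0)%E.
  have pos x : `|gauss_pow k (@enorm R d.+1 x)| = gauss_pow k (enorm x).
    by rewrite ger0_norm// mulr_ge0 ?gauss_fun_ge0 ?exprn_ge0 ?enorm_ge0.
  under eq_integral do rewrite abse_EFin pos.
  rewrite -(fineK (integrable_fin_num measurableT ig)); congr EFin.
  rewrite -[RHS]c0 /radial_moment /Rintegral; congr fine.
  have mg : measurable_fun setT (EFin \o @gauss_pow R k).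
    by apply/measurable_EFinP; exact: measurable_gauss_pow.
  by rewrite [RHS](integral_pushforward (@measurable_enorm R d.+1) mg) ?preimage_setT.
move/(ae_eq_integral_abs _ measurableT (measurable_int _ ig)).1 => -[N [mN N0 sN]].
apply/eqP; rewrite -measure_le0 -(setIT setT).
have mZ : measurable (@enorm R d.+1 @^-1` `]-oo, 0]) by exact: measurable_enorm_preimage.
apply: (@le_trans _ _ (lambda (N `|` @enorm R d.+1 @^-1` `]-oo, 0]))).
  apply: le_measure; rewrite ?inE ?setIT//; first exact: measurableU.
  move=> x _; have [x0|x0] := leP (enorm x) 0; [right; rewrite /= in_itv//|left].
  apply: sN => /= /(_ I) [] /eqP.
  by rewrite mulf_eq0 expf_eq0 (gt_eqF x0) andbF/= gt_eqF// expR_gt0.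
have -> := measureU0 mN mZ (lebesgue_enorm0 d).
by rewrite N0.
Qed.

Implicit Types a : 'I_d.+1 -> nat.

(** This is the equation |x|^2 = 1 of the sphere, multiplied by x^a and integrated. *)
Lemma sphere_moment_sum a :
  \sum_j sphere_moment (R := R) (fun i => a i + (j == i).*2)%N = sphere_moment (R := R) a.
Proof.
have SE b : (sphere_moment (R := R) b)%:E = (\int[sigma]_(x in @sphere R d) (monomial b x)%:E)%E.
  by rewrite /sphere_moment /Rintegral (fineK (integrable_fin_num (@measurable_sphere R d) (integrable_monomial b))).
apply/eqP; rewrite -eqe; apply/eqP; rewrite -sumEFin SE (eq_bigr _ (fun j _ => SE _)).
rewrite -integral_sum//; last first.
- by move=> j; exact: integrable_monomial.
- exact: measurable_sphere.
apply: eq_integral => x; rewrite inE => Sx; rewrite sumEFin; congr EFin.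
rewrite -[RHS]mul1r -(expr1n _ 2) -[X in X ^+ 2]Sx enorm_sqr mulr_suml.
apply: eq_bigr => j _; rewrite /monomial.
rewrite (bigD1 j)//= eqxx [in RHS](bigD1 j)//= mulrA -exprD addnC; congr (_ * _).
by apply: eq_bigr => i ij; rewrite eq_sym (negbTE ij) addn0.
Qed.

(** Write c_k for the radial moments, M for the spherical ones and K = |g|. The one-dimensional
    recursion gives c_(K+2) M(g + 2 e_j) = (g_j + 1)/2 c_K M(g); summed over j by
    [sphere_moment_sum], it gives c_(K+2) M(g) = (d + K + 1)/2 c_K M(g). Comparing the two
    eliminates the radial moments. *)
Lemma sphere_moment_rec a i :
  (d + \sum_j a j)%:R * sphere_moment (R := R) (fun j => a j + (i == j))%N =
  (a i)%:R * sphere_moment (R := R) (fun j => a j - (i == j))%N.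
Proof.
have aD b j k : \prod_l @gauss_moment R (b l + (j == l) * k)%N =
    gauss_moment (b j + k)%N * \prod_(l | l != j) gauss_moment (b l).
  rewrite (bigD1 j)//= eqxx mul1n; congr (_ * _).
  by apply: eq_bigr => l lj; rewrite eq_sym (negbTE lj) addn0.
have sD b j k : (\sum_l (b l + (j == l) * k) = \sum_l b l + k)%N.
  rewrite big_split/=; congr addn; rewrite (bigD1 j)//= eqxx mul1n big1 ?addn0// => l lj.
  by rewrite eq_sym (negbTE lj).
(* If [a i = 0], the moment on the left is odd in the coordinate [i]: its Gaussian product contains
   the first moment, which is 0. *)
have [ai0|ai0] := eqVneq (a i) 0%N.
  rewrite ai0 mul0r.
  have e : (fun j => a j + (i == j))%N = (fun j => a j + (i == j) * 1)%N.
    by apply/funext => j; rewrite muln1.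
  rewrite e; have := radial_sphere_moment (R := R) (fun j => a j + (i == j) * 1)%N.
  rewrite aD ai0 add0n.
  have /eqP := gauss_moment_rec (R := R) 0; rewrite mul0r mulf_eq0 pnatr_eq0/= => /eqP ->.
  by rewrite mul0r mulr0 => /eqP; rewrite mulf_eq0 (negbTE (radial_moment_neq0 _)) => /eqP ->; rewrite mulr0.
(* The two moments of the claim are then those of g + 2 e_i and of g. *)
pose g j := (a j - (i == j))%N.
have ag : a = (fun j => g j + (i == j) * 1)%N.
  apply/funext => j; rewrite /g muln1; case: eqVneq => [<-|_]; last by rewrite subn0 addn0.
  by rewrite subnK// lt0n.
have e2 j : (fun l => g l + (j == l).*2)%N = (fun l => g l + (j == l) * 2)%N.
  by apply/funext => l; rewrite muln2.
have M2 j : \prod_l @gauss_moment R (g l + (j == l) * 2)%N =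
    (g j + 1)%:R / 2 * \prod_l gauss_moment (g l).
  rewrite aD addn2 [in RHS](bigD1 j)//= mulrA; congr (_ * _).
  have := @gauss_moment_rec R (g j).+1; rewrite /= addn1 => h.
  by rewrite mulrAC -h mulrC mulKf// pnatr_eq0.
set K := (\sum_l g l)%N.
have cS2 j : radial_moment (R := R) d (K + 2) * sphere_moment (R := R) (fun l => g l + (j == l).*2)%N
    = (g j + 1)%:R / 2 * (radial_moment (R := R) d K * sphere_moment (R := R) g).
  rewrite radial_sphere_moment e2 -(sD _ _ j) radial_sphere_moment M2.
  by rewrite mulrCA.
have cS : radial_moment (R := R) d (K + 2) * sphere_moment (R := R) g =
   (d + K + 1)%:R / 2 * (radial_moment (R := R) d K * sphere_moment (R := R) g).
  rewrite -[in LHS]sphere_moment_sum mulr_sumr (eq_bigr _ (fun j _ => cS2 j)).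
  rewrite -mulr_suml -mulr_suml -natr_sum big_split/= sum1_card card_ord.
  by rewrite -addnA [(d + _)%N]addnCA addn1.
have -> : (fun j => a j + (i == j))%N = (fun l => g l + (i == l).*2)%N.
  by apply/funext => j; rewrite {1}ag muln1 -addnA addnn.
apply: (mulfI (radial_moment_neq0 (K + 2))).
have -> : (d + \sum_j a j = d + K + 1)%N by rewrite {1}ag sD addnA.
have -> : a i = (g i + 1)%N by rewrite {1}ag eqxx.
rewrite mulrCA cS2 [RHS]mulrCA cS.
by ring.
Qed.

End sphere_moment_rec.

(** * The mean of a polynomial over the sphere *)

Local Open Scope complex_scope.

Section sphere_mean.
Context {R : realType} (d : nat).
Local Notation euclidean n := (n.-tuple (measurableTypeR R)).
Local Notation sigma := (@sphere_measure R d).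
Local Notation S := (@sphere R d).
Local Notation MP := (mpoly d.+1 R[i]).
Local Notation area := (fine (sigma setT)).

Definition cintegrable (f : euclidean d.+1 -> R[i]) : Prop :=
  sigma.-integrable S (EFin \o (fun x => complex.Re (f x))) /\
  sigma.-integrable S (EFin \o (fun x => complex.Im (f x))).

Lemma cintegrableD f g : cintegrable f -> cintegrable g ->
  cintegrable (fun x => f x + g x) /\
  cintegral (fun x => f x + g x) = cintegral f + cintegral g.
Proof.
move=> [rf jf] [rg jg]; have mS := @measurable_sphere R d.
have eR x : complex.Re (f x + g x) = complex.Re (f x) + complex.Re (g x).
  by case: (f x) (g x) => [? ?] [].
have eI x : complex.Im (f x + g x) = complex.Im (f x) + complex.Im (g x).
  by case: (f x) (g x) => [? ?] [].
rewrite /cintegrable /cintegral (funext eR) (funext eI) !RintegralD//.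
by split => //; split; [exact: (integrableD mS rf rg)|exact: (integrableD mS jf jg)].
Qed.

Lemma cintegrableZ c f : cintegrable f ->
  cintegrable (fun x => c * f x) /\
  cintegral (fun x => c * f x) = c * cintegral f.
Proof.
case: c => a b [rf jf]; have mS := @measurable_sphere R d.
have eR x : complex.Re ((a +i* b) * f x) = a * complex.Re (f x) - b * complex.Im (f x).
  by case: (f x).
have eI x : complex.Im ((a +i* b) * f x) = a * complex.Im (f x) + b * complex.Re (f x).
  by case: (f x).
have ar := integrableZl mS a rf; have br := integrableZl mS b rf.
have aj := integrableZl mS a jf; have bj := integrableZl mS b jf.
rewrite /cintegrable /cintegral (funext eR) (funext eI).
rewrite RintegralB// RintegralD// !RintegralZl//.
by split => //; split; [exact: (integrableB mS ar bj)|exact: (integrableD mS aj br)].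
Qed.

Lemma polyfunX (m : multinom d.+1) (x : euclidean d.+1) :
  polyfun (mpolyX R[i] m) x = (monomial m x)%:C.
Proof.
by rewrite /polyfun mevalX /monomial rmorph_prod; apply: eq_bigr => i _; rewrite rmorphXn.
Qed.

Lemma cintegrableX (m : multinom d.+1) :
  cintegrable (polyfun (mpolyX R[i] m)) /\
  cintegral (polyfun (mpolyX R[i] m)) = (sphere_moment (R := R) m)%:C.
Proof.
rewrite /cintegrable /cintegral (funext (polyfunX m)) /=; split.
  split; first exact: integrable_monomial.
  by apply: eq_integrable (@integrable0 _ _ _ sigma S) => //; exact: measurable_sphere.
by rewrite Rintegral_cst ?mul0r//; exact: measurable_sphere.
Qed.

Lemma polyfunD n (p q : mpoly n R[i]) :
  polyfun (p + q) = (fun x => polyfun p x + polyfun q x).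
Proof. by apply/funext => x; rewrite /polyfun mevalD. Qed.

Lemma polyfunZ n c (p : mpoly n R[i]) :
  polyfun (c *: p) = (fun x => c * polyfun p x).
Proof. by apply/funext => x; rewrite /polyfun mevalZ. Qed.

Lemma cintegrable_polyfun (p : MP) : cintegrable (polyfun p).
Proof.
elim/mpolyind: p => [|c m p _ _ ip].
  rewrite -(scale0r (mpolyX R[i] (@mnm0 d.+1))) polyfunZ.
  by apply: (cintegrableZ _ _).1; exact: (cintegrableX _).1.
rewrite polyfunD polyfunZ; apply: (cintegrableD _ _).1 => //.
by apply: (cintegrableZ _ _).1; exact: (cintegrableX _).1.
Qed.

Definition sphere_mean (p : MP) : R[i] :=
  (sphere_area R d)%:C^-1 * cintegral (polyfun p).

Lemma sphere_meanZ c p : sphere_mean (c *: p) = c * sphere_mean p.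
Proof.
by rewrite /sphere_mean polyfunZ (cintegrableZ c (cintegrable_polyfun p)).2 mulrCA.
Qed.

Lemma sphere_meanD p q : sphere_mean (p + q) = sphere_mean p + sphere_mean q.
Proof.
rewrite /sphere_mean polyfunD -mulrDr.
by rewrite (cintegrableD (cintegrable_polyfun p) (cintegrable_polyfun q)).2.
Qed.

Lemma sphere_meanX (m : multinom d.+1) :
  sphere_mean (mpolyX R[i] m) = (sphere_moment (R := R) m / area)%:C.
Proof.
by rewrite /sphere_mean (cintegrableX m).2 sphere_areaE rmorphM/= fmorphV mulrC.
Qed.

Lemma sphere_mean1 : sphere_mean 1 = 1.
Proof.
rewrite -mpolyX0 sphere_meanX.
have -> : sphere_moment (R := R) (@mnm0 d.+1) = area.
  rewrite -sphere_areaE /sphere_area -[RHS]mul1r -Rintegral_cst; last exact: measurable_sphere.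
  by apply: eq_Rintegral => x _; rewrite /monomial big1// => i _; rewrite mnm0E.
by rewrite divff// gt_eqF// sphere_area_gt0.
Qed.

Lemma sphere_meanX_rec (i : 'I_d.+1) (m : multinom d.+1) :
  (d + mdeg m)%:R * sphere_mean (mpolyX R[i] (mnm_add (mnm1 i) m)) =
  (m i)%:R * sphere_mean (mpolyX R[i] (mnm_sub m (mnm1 i))).
Proof.
rewrite !sphere_meanX.
have h := sphere_moment_rec (R := R) m i.
rewrite -mdegE in h.
rewrite -[(d + _)%:R](rmorph_nat (real_complex R)) -[(m i)%:R](rmorph_nat (real_complex R)).
rewrite -!rmorphM/= !mulrA; congr (_ / _)%:C.
have -> : (fun_of_multinom (mnm_add (mnm1 i) m)) = (fun j => m j + (i == j))%N.
  by apply/funext => j; rewrite mnmDE mnm1E addnC.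
have -> // : (fun_of_multinom (mnm_sub m (mnm1 i))) = (fun j => m j - (i == j))%N.
by apply/funext => j; rewrite mnmBE mnm1E.
Qed.

End sphere_mean.

Local Close Scope complex_scope.

(** * Algebra of the means *)

(* The last field reads (d + |m|) L (x_i x^m) = L (d/dx_i x^m); the truncation in
   m - U_i only occurs when the coefficient m i is 0. *)
Record sphere_functional (K : numFieldType) (d : nat) (L : mpoly d.+1 K -> K) : Prop := {
  sf_one : L 1 = 1;
  sf_add : forall p q, L (p + q) = L p + L q;
  sf_scale : forall c p, L (c *: p) = c * L p;
  sf_mul_monomial : forall (i : 'I_d.+1) (m : multinom d.+1),
    (d + mdeg m)%:R * L (mpolyX K (mnm_add (mnm1 i) m)) =
    (m i)%:R * L (mpolyX K (mnm_sub m (mnm1 i))) }.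

Section sphere_functional_theory.
Context (K : numFieldType) (d : nat) (L : mpoly d.+1 K -> K).
Hypothesis sfL : sphere_functional L.
Implicit Types (p q : mpoly d.+1 K) (i j : 'I_d.+1).

Local Notation var i := (mpolyX K (mnm1 i)).
Local Notation homog e := (ishomog1 e (@mdeg d.+1)).

Lemma sf_sub p q : L (p - q) = L p - L q.
Proof. by rewrite -scaleN1r (sf_add sfL) (sf_scale sfL) mulN1r. Qed.

Lemma sf_zero : L 0 = 0.
Proof. by rewrite -(scale0r 1) (sf_scale sfL) mul0r. Qed.

Lemma sf_sum (I : Type) (r : seq I) (F : I -> mpoly d.+1 K) :
  L (\sum_(k <- r) F k) = \sum_(k <- r) L (F k).
Proof. exact: (big_morph L (sf_add sfL) sf_zero). Qed.

(** All monomials of [p] have degree [e], so the factor in [sf_mul_monomial] is the same for each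
    and the rule extends linearly. *)
Lemma sf_mul_var i e p : p \is homog e ->
  (d + e)%:R * L (var i * p) = L (mderiv i p).
Proof.
move=> /dhomogP hp; rewrite [p in LHS]mpolyE [p in RHS]mpolyE.
rewrite (big_morph _ (mderivD i) (mderiv0 _ i)) mulr_sumr !sf_sum mulr_sumr.
apply: eq_big_seq => m /hp me.
rewrite -scalerAr -mpolyXD mderivZ mderivX !(sf_scale sfL).
by rewrite mulrCA -me (sf_mul_monomial sfL).
Qed.

(* If c^2 = -1, then cvar c i j is z = x_i + c x_j, cvar (- c) i j is its
   conjugate, and cderiv c i j is twice the derivation d/d(conj z). *)
Definition cvar (c : K) i j : mpoly d.+1 K := var i + c *: (var j).
Definition cderiv (c : K) i j p := mderiv i p + c *: mderiv j p.

Lemma cvar_homog c i j : cvar c i j \is homog 1.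
Proof. by apply: rpredD; [|apply: rpredZ]; rewrite dhomogX /= mdeg1. Qed.

Lemma cvarX_homog c i j n : cvar c i j ^+ n \is homog n.
Proof. by have := dhomogMn n (cvar_homog c i j); rewrite mul1n. Qed.

Lemma cderiv1 c i j : cderiv c i j 1 = 0.
Proof. by rewrite /cderiv -mpolyC1 !mderivC scaler0 addr0. Qed.

Lemma cderivM c i j p q :
  cderiv c i j (p * q) = cderiv c i j p * q + p * cderiv c i j q.
Proof.
rewrite /cderiv !mderivM -!mul_mpolyC; ring.
Qed.

Lemma cderivX c i j p n :
  cderiv c i j (p ^+ n.+1) = n.+1%:R * p ^+ n * cderiv c i j p.
Proof.
elim: n => [|n IH]; first by rewrite expr1 expr0 !mul1r.
rewrite exprS cderivM IH; move: (cderiv c i j p) => D {IH}.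
rewrite -[n.+2%:R]natr1 2!mulrDl mul1r addrC; congr (_ + _); last exact: mulrC.
by rewrite mulrA mulrCA -exprS.
Qed.

Lemma mderiv_var i j : mderiv i (var j) = (i == j)%:R :> mpoly d.+1 K.
Proof.
rewrite mderivX mnm1E eq_sym; case: eqVneq => [->|_]; last by rewrite scale0r.
by rewrite scale1r -mpolyX0; congr mpolyX; apply/mnmP => k; rewrite mnmBE mnm0E subnn.
Qed.

Lemma cderiv_cvar c c' i j : i != j ->
  cderiv c i j (cvar c' i j) = mpolyC d.+1 (1 + c * c').
Proof.
move=> ij; have ji : (j == i) = false by rewrite eq_sym (negbTE ij).
rewrite /cderiv /cvar !mderivD !mderivZ !mderiv_var !eqxx (negbTE ij) ji.
rewrite scaler0 addr0 add0r mpolyCD mpolyC1; congr (_ + _).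
by rewrite scalerA -mul_mpolyC mulr1.
Qed.

Lemma cderiv_cvar_sep c c' i j k l : [&& i != k, i != l, j != k & j != l] ->
  cderiv c i j (cvar c' k l) = 0.
Proof.
move=> /and4P[ik il jk jl].
rewrite /cderiv /cvar !mderivD !mderivZ !mderiv_var.
by rewrite (negbTE ik) (negbTE il) (negbTE jk) (negbTE jl) !(scaler0, addr0).
Qed.

Section complex_pair.
Variables (c : K) (i j : 'I_d.+1).
Hypotheses (c2 : c ^+ 2 = -1) (ij : i != j).
Local Notation w := (cvar c i j).
Local Notation w' := (cvar (- c) i j).

Lemma sf_mul_cvar e p : p \is homog e ->
  (d + e)%:R * L (w * p) = L (cderiv c i j p).
Proof.
move=> hp; rewrite mulrDl -scalerAl (sf_add sfL) (sf_scale sfL) mulrDr mulrCA.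
by rewrite !(sf_mul_var _ hp) (sf_add sfL) (sf_scale sfL).
Qed.

(** The derivation kills [w], because 1 + c^2 = 0, and sends [w'] to 1 - c^2 = 2, so only the [n]
    factors [w'] contribute. For [n = 0] the truncated [n.-1] has coefficient 0. *)
Lemma sf_cvar_pow m n e q : q \is homog e -> cderiv c i j q = 0 ->
  (d + (m + n + e))%:R * L (w ^+ m.+1 * w' ^+ n * q) =
  2 * n%:R * L (w ^+ m * w' ^+ n.-1 * q).
Proof.
move=> hq dq.
have hp : w ^+ m * w' ^+ n * q \is homog (m + n + e).
  by apply: dhomogM => //; apply: dhomogM; exact: cvarX_homog.
have -> : w ^+ m.+1 * w' ^+ n * q = w * (w ^+ m * w' ^+ n * q).
  by rewrite exprS !mulrA.
rewrite (sf_mul_cvar hp) !cderivM dq mulr0 addr0.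
have -> : cderiv c i j (w ^+ m) = 0.
  case: m {hp} => [|m]; first by rewrite expr0 cderiv1.
  by rewrite cderivX cderiv_cvar// -expr2 c2 subrr mpolyC0 mulr0.
rewrite mul0r add0r; case: n {hp} => [|n].
  by rewrite expr0 cderiv1 mulr0 mul0r mulr0 mul0r sf_zero.
rewrite cderivX cderiv_cvar// mulrN -expr2 c2 opprK /=.
rewrite -(sf_scale sfL) -mul_mpolyC; congr L.
rewrite mpolyCM mpolyC_nat; ring.
Qed.
End complex_pair.

(** Lowering both exponents together leads to the case where one of them is 0 and the recursion has
    coefficient 0. The hypothesis [0 < d] makes the factors on the left invertible. *)
Lemma sf_cvar_pow_neq c i j m n e q :
  c ^+ 2 = -1 -> i != j -> (0 < d)%N ->
  q \is homog e -> cderiv c i j q = 0 -> cderiv (- c) i j q = 0 ->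
  m != n -> L (cvar c i j ^+ m * cvar (- c) i j ^+ n * q) = 0.
Proof.
move=> c2 ij d0 hq dq dq'.
have nz k : (d + k)%:R != 0 :> K by rewrite pnatr_eq0 addn_eq0 negb_and -lt0n d0.
elim: m n => [|m IH] [|n]//.
- move=> _; apply: (mulfI (nz (n + 0 + e)%N)).
  (* Replacing [c] by [- c] exchanges the complex variable and its conjugate. *)
  rewrite expr0 mul1r mulr0; have c2' : (- c) ^+ 2 = -1 by rewrite sqrrN.
  have := sf_cvar_pow c2' ij n 0 hq dq'.
  by rewrite opprK expr0 mulr1 mulr0 mul0r.
- move=> _; apply: (mulfI (nz (m + 0 + e)%N)).
  by rewrite (sf_cvar_pow c2 ij m 0 hq dq) !mulr0 mul0r.
rewrite eqSS => mn; apply: (mulfI (nz (m + n.+1 + e)%N)).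
by rewrite (sf_cvar_pow c2 ij m n.+1 hq dq) IH// !mulr0.
Qed.

End sphere_functional_theory.

(** The recursions of m! n! / (m + n + 1)!: the first lowers [m], and the second lowers [n] once [m]
    is 0. *)
Lemma mulr_fact_eq (K : numFieldType) (f : nat -> nat -> K) :
  f 0%N 0%N = 1 ->
  (forall m n, (m + n + 2)%:R * f m.+1 n = m.+1%:R * f m n) ->
  (forall n, (n + 2)%:R * f 0%N n.+1 = n.+1%:R * f 0%N n) ->
  forall m n, ((m + n).+1)`!%:R * f m n = (m`! * n`!)%:R.
Proof.
move=> f00 fm fn; elim=> [|m IH] n.
  elim: n => [|n IH]; first by rewrite f00 mulr1.
  rewrite add0n factS natrM mulrAC -(addn2 n) mulrC fn mulrCA mulrC.
  by rewrite -[n.+1 in LHS]/(0 + n).+1 mulrC IH !fact0 !mul1n factS natrM mulrC.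
rewrite addSn factS natrM mulrAC -(addn2 (m + n)) mulrC fm mulrCA IH.
by rewrite factS -!natrM mulnA.
Qed.

(** * Means over the two-sphere as Beta integrals in the height [xi] *)

Section two_sphere.
Context (K : numFieldType) (L : mpoly 3 K -> K).
Hypothesis sfL : sphere_functional L.
Local Notation xi := (mpolyX K (mnm1 (0 : 'I_3))).
Local Notation A := (mpoly 3 K).

(* At the Hopf image of (a, b) these take the values |a|^2 and |b|^2. *)
Definition upper : A := 2^-1 *: (1 + xi).
Definition lower : A := 2^-1 *: (1 - xi).

Lemma xi_homog n : xi ^+ n \is ishomog1 n (@mdeg 3).
Proof.
(* With [c = 0] a complex variable reduces to its first coordinate, so the results on [cvar] apply
   to [xi]. *)
have -> : xi = cvar 0 0 0 by rewrite /cvar scale0r addr0.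
exact: cvarX_homog.
Qed.

(** The mean of xi^n is half the integral of x^n over [-1, 1]. The recursion on exponents has step
    two, hence the induction on pairs of consecutive exponents. *)
Lemma sf_S2_xi_pow n : 2 * n.+1%:R * L (xi ^+ n) = 1 - (-1) ^+ n.+1.
Proof.
have xiE : xi = cvar 0 0 0 by rewrite /cvar scale0r addr0.
have rec k : (2 + k)%:R * L (xi ^+ k.+1) = k%:R * L (xi ^+ k.-1).
  rewrite exprS {1}xiE (sf_mul_cvar sfL _ _ _ (xi_homog k)).
  case: k => [|k]; first by rewrite expr0 cderiv1 (sf_zero sfL) mul0r.
  rewrite cderivX /cderiv mderiv_var scale0r addr0 mulr1 -(sf_scale sfL); congr L.
  by rewrite -mul_mpolyC mpolyC_nat.
suff : 2 * n.+1%:R * L (xi ^+ n) = 1 - (-1) ^+ n.+1 /\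
  2 * n.+2%:R * L (xi ^+ n.+1) = 1 - (-1) ^+ n.+2 by case.
elim: n => [|n [IH1 IH2]]; split => //.
- by rewrite expr0 (sf_one sfL) expr1; ring.
- by have /= := rec 0%N; rewrite mul0r -mulrA => ->; rewrite mulr0 expr2; ring.
rewrite -mulrA (rec n.+1) /= mulrA IH1 !exprS; ring.
Qed.

Definition xi_poly (p : {poly K}) : A := horner_alg xi p.

Lemma xi_polyZ a p : xi_poly (a *: p) = a *: xi_poly p.
Proof. by rewrite /xi_poly linearZ/= mulr_algl. Qed.

Lemma xi_polyXn n : xi_poly 'X^n = xi ^+ n.
Proof. by rewrite /xi_poly rmorphXn/= horner_algX. Qed.

(* Archimedes: xi is uniformly distributed on [-1, 1]. *)
Lemma sf_S2_deriv (p : {poly K}) : 2 * L (xi_poly p^`()) = p.[1] - p.[-1].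
Proof.
rewrite -[p]coefK poly_def (raddf_sum (@deriv K)) {1}/xi_poly (raddf_sum (horner_alg xi)) -/xi_poly.
rewrite (sf_sum sfL) mulr_sumr.
rewrite !horner_sum -sumrB; apply: eq_bigr => i _.
rewrite /= derivZ derivXn -/(xi_poly _) xi_polyZ (sf_scale sfL) !hornerZ !hornerXn expr1n.
case: (nat_of_ord i) => [|k].
  by rewrite mulr0n /xi_poly raddf0 (sf_zero sfL) !mulr0 expr0 mulr1 subrr.
rewrite -['X^_ *+ _]scaler_nat xi_polyZ (sf_scale sfL) xi_polyXn /=.
by rewrite mulrCA [2 * _]mulrA -mulrBr sf_S2_xi_pow.
Qed.

(** Univariate forms of [upper] and [lower]. They vanish at -1 and at 1 respectively, which removes
    the boundary terms below. *)
Let u : {poly K} := 2^-1 *: (1 + 'X).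
Let v : {poly K} := 2^-1 *: (1 - 'X).

Let uvE m n : xi_poly (u ^+ m * v ^+ n) = upper ^+ m * lower ^+ n.
Proof.
rewrite /xi_poly rmorphM !rmorphXn/= -!/(xi_poly _) /u /v !xi_polyZ.
by rewrite /xi_poly rmorphD rmorphB/= rmorph1 horner_algX.
Qed.

Let n2 : (2 : K) != 0. Proof. by rewrite pnatr_eq0. Qed.

Let uv1 : [/\ u.[1] = 1, u.[-1] = 0, v.[1] = 0 & v.[-1] = 1].
Proof. by rewrite /u /v !hornerE; split; field. Qed.

Let du : u^`() = (2^-1)%:P.
Proof. by rewrite /u derivZ derivD derivX derivC add0r -alg_polyC. Qed.

Let dv : v^`() = - (2^-1)%:P.
Proof. by rewrite /v derivZ derivB derivX derivC sub0r scalerN -alg_polyC. Qed.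

(** A Beta integral, with [sf_S2_deriv] as the fundamental theorem of calculus: applied to u^(k+1)
    v^(l+1) it trades a factor [lower] for a factor [upper], until only powers of [upper] remain. *)
Lemma sf_S2_beta m n :
  ((m + n).+1)`!%:R * L (upper ^+ m * lower ^+ n) = (m`! * n`!)%:R.
Proof.
have [u1 uN v1 vN] := uv1.
have B0 k : k.+1%:R * L (upper ^+ k * lower ^+ 0) = 1.
  have := sf_S2_deriv (u ^+ k.+1); rewrite !horner_exp u1 uN expr1n expr0n subr0.
  rewrite deriv_exp du.
  have -> : 2^-1%:P * u ^+ k.+1.-1 *+ k.+1 = 2^-1 *: (k.+1%:R *: (u ^+ k * v ^+ 0)).
    by rewrite expr0 /= -!mul_polyC !polyC_natr; ring.
  rewrite !xi_polyZ !(sf_scale sfL). by rewrite (mulVKf n2) uvE.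
have BS k l : k.+1%:R * L (upper ^+ k * lower ^+ l.+1) =
    l.+1%:R * L (upper ^+ k.+1 * lower ^+ l).
  have := sf_S2_deriv (u ^+ k.+1 * v ^+ l.+1).
  rewrite !hornerM !horner_exp v1 uN !expr0n !(mul0r, mulr0) subr0 derivM !deriv_exp du dv.
  have -> : 2^-1%:P * u ^+ k.+1.-1 *+ k.+1 * v ^+ l.+1 +
      u ^+ k.+1 * (- 2^-1%:P * v ^+ l.+1.-1 *+ l.+1) =
      2^-1 *: (k.+1%:R *: (u ^+ k * v ^+ l.+1) - l.+1%:R *: (u ^+ k.+1 * v ^+ l)).
    by rewrite /= -!mul_polyC !polyC_natr; ring.
  rewrite xi_polyZ (sf_scale sfL) (mulVKf n2).
  rewrite /xi_poly rmorphB/= -!/(xi_poly _) !xi_polyZ.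
  rewrite (sf_sub sfL) !(sf_scale sfL) !uvE => /eqP.
  by rewrite subr_eq0 => /eqP.
elim: n m => [|n IH] m.
  by rewrite addn0 factS natrM mulrAC B0 mul1r fact0 muln1.
have nz : (m.+1%:R : K) != 0 by rewrite pnatr_eq0.
apply: (mulfI nz); rewrite mulrCA BS mulrCA -addSnnS IH -!natrM; congr _%:R.
by rewrite !factS; ring.
Qed.

(** The second factor is a polynomial in [xi], which the derivations in the coordinates 1 and 2
    kill. The exponents of the complex variable and of its conjugate are [k.+1] and 0, so
    [sf_cvar_pow_neq] applies to each power of [xi]. *)
Lemma sf_S2_cvar_pow c k m n : c ^+ 2 = -1 ->
  L (cvar c 1 2 ^+ k.+1 * (upper ^+ m * lower ^+ n)) = 0.
Proof.
move=> c2; rewrite -uvE; move: (u ^+ m * v ^+ n) => p.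
rewrite -[p]coefK poly_def {1}/xi_poly (raddf_sum (horner_alg xi)) mulr_sumr.
rewrite (sf_sum sfL) big1// => i _.
rewrite /= -/(xi_poly _) xi_polyZ -scalerAr (sf_scale sfL) xi_polyXn.
have d0 c' : cderiv c' 1 2 (xi ^+ i) = 0.
  case: (nat_of_ord i) => [|l]; first by rewrite expr0 cderiv1.
  have s : cderiv c' 1 2 xi = 0.
    have -> : xi = cvar 0 0 0 by rewrite /cvar scale0r addr0.
    by rewrite cderiv_cvar_sep.
  by rewrite cderivX s mulr0.
have := sf_cvar_pow_neq (n := 0) sfL c2 (erefl : (1 : 'I_3) != 2) isT (xi_homog i) (d0 c) (d0 (- c)).
by move=> /(_ k.+1 isT); rewrite expr0 mulr1 => ->; rewrite mulr0.
Qed.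

End two_sphere.

Section circle.
Context (K : numFieldType) (L : mpoly 2 K -> K).
Hypothesis sfL : sphere_functional L.

Lemma sf_S1_cvar_pow c k : c ^+ 2 = -1 -> L (cvar c 0 1 ^+ k.+1) = 0.
Proof.
move=> c2.
have := sf_cvar_pow_neq (n := 0) sfL c2 (erefl : (0 : 'I_2) != 1) isT (dhomog1 _ _)
  (cderiv1 _ _ _) (cderiv1 _ _ _).
by move=> /(_ k.+1 isT); rewrite expr0 !mulr1.
Qed.
End circle.

(** * Means over the three-sphere in two complex variables and their conjugates *)

Section three_sphere.
Context (K : numFieldType) (L : mpoly 4 K -> K) (c : K).
Hypotheses (sfL : sphere_functional L) (c2 : c ^+ 2 = -1).

(** With [c] the imaginary unit this is a^i (conj a)^j b^k (conj b)^l, where a = x_0 + c x_1 and b =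
    x_2 + c x_3. *)
Definition bimonomial i j k l : mpoly 4 K :=
  cvar c 0 1 ^+ i * cvar (- c) 0 1 ^+ j * (cvar c 2 3 ^+ k * cvar (- c) 2 3 ^+ l).

Let sep01 c' k l : cderiv (d := 3) c' 0 1 (cvar c 2 3 ^+ k * cvar (- c) 2 3 ^+ l) = 0.
Proof.
have s c'' : cderiv (d := 3) c' 0 1 (cvar c'' 2 3) = 0.
  by rewrite cderiv_cvar_sep.
rewrite cderivM; case: k => [|k]; case: l => [|l];
  by rewrite ?expr0 ?cderiv1 ?cderivX ?s !(mulr0, mul0r, addr0).
Qed.

Let sep23 c' k l : cderiv (d := 3) c' 2 3 (cvar c 0 1 ^+ k * cvar (- c) 0 1 ^+ l) = 0.
Proof.
have s c'' : cderiv (d := 3) c' 2 3 (cvar c'' 0 1) = 0.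
  by rewrite cderiv_cvar_sep.
rewrite cderivM; case: k => [|k]; case: l => [|l];
  by rewrite ?expr0 ?cderiv1 ?cderivX ?s !(mulr0, mul0r, addr0).
Qed.

Let homog2 i j k l :
  (cvar c i j ^+ k * cvar (- c) i j ^+ l : mpoly 4 K) \is ishomog1 (k + l) (@mdeg 4).
Proof. by apply: dhomogM; exact: cvarX_homog. Qed.

Lemma sf_S3_bimonomial_neq i j k l :
  (i != j) || (k != l) -> L (bimonomial i j k l) = 0.
Proof.
case/orP => h; rewrite /bimonomial.
  exact: (sf_cvar_pow_neq sfL c2 _ _ (homog2 2 3 k l)).
rewrite mulrC.
exact: (sf_cvar_pow_neq sfL c2 _ _ (homog2 0 1 i j)).
Qed.

(** For [d = 3] both sides of [sf_cvar_pow] are even, with factors 2 (m + n + 2) and 2 (m + 1);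
    halved, they give the recursions of [mulr_fact_eq]. *)
Lemma sf_S3_beta m n :
  ((m + n).+1)`!%:R * L (bimonomial m m n n) = (m`! * n`!)%:R.
Proof.
have n2 : (2 : K) != 0 by rewrite pnatr_eq0.
apply: (mulr_fact_eq (f := fun m n => L (bimonomial m m n n))) => {m n} [|m n|n].
- by rewrite /bimonomial !expr0 !mul1r (sf_one sfL).
- have := sf_cvar_pow sfL c2 (erefl : (0 : 'I_4) != 1) m m.+1 (homog2 2 3 n n) (sep01 _ _ _).
  rewrite /= -!/(bimonomial _ _ _ _) => h; apply: (mulfI n2).
  by rewrite !mulrA -h -natrM; congr (_%:R * _); lia.
- have := sf_cvar_pow sfL c2 (erefl : (2 : 'I_4) != 3) n n.+1 (homog2 0 1 0 0) (sep23 _ _ _).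
  rewrite /= (mulrC (cvar c 2 3 ^+ n.+1 * _)) (mulrC (cvar c 2 3 ^+ n * _)) -!/(bimonomial _ _ _ _) => h.
  apply: (mulfI n2).
  by rewrite !mulrA -h -natrM; congr (_%:R * _); lia.
Qed.
End three_sphere.

Section msize_le.
Context (K : numFieldType) (n : nat).
Implicit Types p q : mpoly n K.

Lemma homog_msize_le e p : p \is ishomog1 e (@mdeg n) -> (msize p <= e.+1)%N.
Proof.
move=> /dhomogP hp; rewrite msizeE; apply/bigmax_leqP_seq => m mp _.
by rewrite ltnS (hp m mp).
Qed.

Lemma msizeM_leS a b p q :
  (msize p <= a.+1 -> msize q <= b.+1 -> msize (p * q) <= (a + b).+1)%N.
Proof.
have [->|p0] := eqVneq p 0; first by rewrite mul0r msize0.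
have [->|q0] := eqVneq q 0; first by rewrite mulr0 msize0.
move=> pa qb; rewrite msizeM// -[(a + b).+1]/((a + b).+2.-1) -addSn -addnS -!subn1.
by rewrite leq_sub2r// leq_add.
Qed.

Lemma msizeX_leS a p k : (msize p <= a.+1 -> msize (p ^+ k) <= (a * k).+1)%N.
Proof.
move=> pa; elim: k => [|k IH]; first by rewrite expr0 msize1.
by rewrite exprS mulnS; exact: msizeM_leS.
Qed.

End msize_le.

(** * Reduction of arbitrary polynomials to bimonomials *)

Section bimonomial_span.
Context (K : numFieldType) (c : K).
Hypothesis c2 : c ^+ 2 = -1.
Variable H : mpoly 4 K -> Prop.
Hypotheses (HD : forall p q, H p -> H q -> H (p + q))
           (HZ : forall a p, H p -> H (a *: p)).
Variable e : nat.
Hypothesis Hbi : forall i j k l, (i + j + k + l <= e)%N -> H (bimonomial c i j k l).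

Let var_cvar (r s : 'I_4) :
  mpolyX K (mnm1 r) = 2^-1 *: cvar c r s + 2^-1 *: cvar (- c) r s /\
  mpolyX K (mnm1 s) = (2 * c)^-1 *: cvar c r s + (- (2 * c)^-1) *: cvar (- c) r s.
Proof.
have n2 : (2 : K) != 0 by rewrite pnatr_eq0.
have c0 : c != 0 by rewrite -sqrf_eq0 c2 oppr_eq0 oner_eq0.
rewrite /cvar !scalerDr !scalerA; split.
  rewrite addrACA -!scalerDl.
  have -> : 2^-1 + 2^-1 = 1 :> K by field.
  have -> : 2^-1 * c + 2^-1 * - c = 0 by ring.
  by rewrite scale1r scale0r addr0.
rewrite addrACA -!scalerDl subrr scale0r add0r.
have -> : (2 * c)^-1 * c + - (2 * c)^-1 * - c = 1 by field.
by rewrite scale1r.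
Qed.

(** Variables are absorbed one at a time: each is a combination of a complex variable and its
    conjugate, and either of these raises one exponent of the bimonomial while the total degree is
    kept. *)
Let HbiX n (m : multinom 4) i j k l : mdeg m = n -> (i + j + k + l + n <= e)%N ->
  H (bimonomial c i j k l * mpolyX K m).
Proof.
elim: n m i j k l => [|n IH] m i j k l.
  move=> /eqP; rewrite mdeg_eq0 addn0 => /eqP-> ijkl.
  by rewrite mpolyX0 mulr1; exact: Hbi.
move=> mn ijkl.
have [r mr] : exists r, (0 < m r)%N.
  apply/existsP; apply: contra_eqT mn => /existsPn m0.
  by rewrite mdegE big1// => r _; apply/eqP; rewrite -leqn0 leqNgt m0.
pose m' := mnm_sub m (mnm1 r).
have em : m = mnm_add (mnm1 r) m'.
  apply/mnmP => s; rewrite mnmDE mnmBE mnm1E.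
  by case: eqVneq => [<-|_]; rewrite ?subn0// subnKC.
have mn' : mdeg m' = n by move: mn; rewrite em mdegD mdeg1 => -[].
have comb (a b : K) p q : H (bimonomial c i j k l * (p * mpolyX K m')) ->
    H (bimonomial c i j k l * (q * mpolyX K m')) ->
    H (bimonomial c i j k l * ((a *: p + b *: q) * mpolyX K m')).
  by move=> hp hq; rewrite mulrDl mulrDr -!scalerAl -!scalerAr; apply: HD; exact: HZ.
have h1 : H (bimonomial c i j k l * (cvar c 0 1 * mpolyX K m')).
  rewrite mulrA (_ : _ * cvar c 0 1 = bimonomial c i.+1 j k l); last first.
    by rewrite /bimonomial exprS; ring.
  by apply: IH => //; lia.
have h2 : H (bimonomial c i j k l * (cvar (- c) 0 1 * mpolyX K m')).
  rewrite mulrA (_ : _ * cvar (- c) 0 1 = bimonomial c i j.+1 k l); last first.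
    by rewrite /bimonomial exprS; ring.
  by apply: IH => //; lia.
have h3 : H (bimonomial c i j k l * (cvar c 2 3 * mpolyX K m')).
  rewrite mulrA (_ : _ * cvar c 2 3 = bimonomial c i j k.+1 l); last first.
    by rewrite /bimonomial exprS; ring.
  by apply: IH => //; lia.
have h4 : H (bimonomial c i j k l * (cvar (- c) 2 3 * mpolyX K m')).
  rewrite mulrA (_ : _ * cvar (- c) 2 3 = bimonomial c i j k l.+1); last first.
    by rewrite /bimonomial exprS; ring.
  by apply: IH => //; lia.
rewrite em mpolyXD.
have [e0 e1] := var_cvar 0 1; have [e2 e3] := var_cvar 2 3.
have : [|| r == 0, r == 1, r == 2 | r == 3] by case: (r) => -[|[|[|[|]]]].
by case/or4P => /eqP ->; rewrite ?e0 ?e1 ?e2 ?e3; exact: comb.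
Qed.

Lemma bimonomial_span p : (msize p <= e.+1)%N -> H p.
Proof.
move=> pe; rewrite [p]mpolyE big_seq.
apply: (big_ind H) => //.
  rewrite -(scale0r (bimonomial c 0 0 0 0)); apply: HZ; exact: Hbi.
move=> m mp; apply: HZ.
have -> : mpolyX K m = bimonomial c 0 0 0 0 * mpolyX K m.
  by rewrite /bimonomial !expr0 !mul1r.
apply: (HbiX (n := mdeg m)) => //.
by have := msize_mdeg_lt mp; lia.
Qed.

End bimonomial_span.

(** * Descent of bimonomials from the three-sphere to the two-sphere *)

Section hopf_poly.
Context (K : numFieldType) (c : K).
Hypothesis c2 : c ^+ 2 = -1.

(* For i + l = j + k, the monomial a^i (conj a)^j b^k (conj b)^l is constant on
   the Hopf fibers, and hopf_poly i j k l is its value in terms of the base point;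
   otherwise its mean over a fiber is 0. *)
Definition hopf_poly i j k l : mpoly 3 K :=
  if (i + l == j + k)%N then
    if (j <= i)%N then
      2^-1 ^+ (i - j) *: (cvar c 1 2 ^+ (i - j) * (upper K ^+ j * lower K ^+ l))
    else
      2^-1 ^+ (j - i) *: (cvar (- c) 1 2 ^+ (j - i) * (upper K ^+ i * lower K ^+ k))
  else 0.

Let msize_upper_lower : (msize (upper K) <= 2)%N /\ (msize (lower K) <= 2)%N.
Proof.
have x2 : (msize (mpolyX K (mnm1 (0%R : 'I_3))) <= 2)%N by rewrite msizeX mdeg1.
split; apply: leq_trans (msizeZ_le _ _) _; apply: leq_trans (msizeD_le _ _) _;
  by rewrite geq_max ?msizeN msize1.
Qed.

(** In the nontrivial case i + l = j + k, so i + j + k + l is even and the bound 2 t + 1 is as good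
    as 2 t: the degree i + l is at most [t]. *)
Lemma msize_hopf_poly t i j k l :
  (i + j + k + l <= 2 * t + 1)%N -> (msize (hopf_poly i j k l) <= t.+1)%N.
Proof.
move=> ijkl; have [su sl] := msize_upper_lower.
have sz (c' : K) e m n : (e + m + n <= t)%N -> forall a : K,
    (msize (a *: (cvar (d := 2) c' 1 2 ^+ e * (upper K ^+ m * lower K ^+ n)))%R <= t.+1)%N.
  move=> emn a; apply: leq_trans (msizeZ_le _ _) _.
  apply: (@leq_trans (e + (1 * m + 1 * n)).+1); last by lia.
  apply: msizeM_leS; first exact: homog_msize_le (cvarX_homog c' 1 2 e).
  by apply: msizeM_leS; exact: msizeX_leS.
rewrite /hopf_poly; case: eqP => [h|_]; last by rewrite msize0.
by case: (leqP j i) => ij; apply: sz; lia.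
Qed.

(** For i = j and k = l both sides are the same Beta value. Otherwise the right one vanishes, and on
    the left [hopf_poly] is 0 or contains a positive power of a complex variable, whose mean is
    0. *)
Lemma sf_hopf_poly (L2 : mpoly 3 K -> K) (L3 : mpoly 4 K -> K) i j k l :
  sphere_functional L2 -> sphere_functional L3 ->
  L2 (hopf_poly i j k l) = L3 (bimonomial c i j k l).
Proof.
move=> s2 s3.
have c2' : (- c) ^+ 2 = -1 by rewrite sqrrN.
have [/andP[/eqP<- /eqP<-]|] := boolP ((i == j) && (k == l)).
  rewrite /hopf_poly eqxx leqnn subnn !expr0 scale1r mul1r.
  have nz : ((i + k).+1)`!%:R != 0 :> K by rewrite pnatr_eq0 -lt0n fact_gt0.
  by apply: (mulfI nz); rewrite (sf_S2_beta s2) (sf_S3_beta s3 c2).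
rewrite negb_and => ne; rewrite [RHS](sf_S3_bimonomial_neq s3 c2 ne) /hopf_poly.
case: eqP => [h|_]; last exact: (sf_zero s2).
case: leqP => ij; rewrite (sf_scale s2).
  (* Since i + l = j + k, the inequalities i != j and k != l imply each other, so the exponent is
     positive. *)
  have -> : (i - j = (i - j).-1.+1)%N by case/orP: ne => /eqP; lia.
  by rewrite (sf_S2_cvar_pow s2)// mulr0.
have -> : (j - i = (j - i).-1.+1)%N by lia.
by rewrite (sf_S2_cvar_pow s2)// mulr0.
Qed.

Lemma meval_cvar d (v : 'I_d.+1 -> K) a i j :
  meval v (cvar a i j) = v i + a * v j.
Proof. by rewrite /cvar mevalD mevalZ !mevalXU. Qed.

Lemma meval_bimonomial (v : 'I_4 -> K) i j k l :
  meval v (bimonomial c i j k l) =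
  (v 0 + c * v 1) ^+ i * (v 0 - c * v 1) ^+ j *
  ((v 2 + c * v 3) ^+ k * (v 2 - c * v 3) ^+ l).
Proof. by rewrite /bimonomial !mevalM !rmorphXn/= !meval_cvar !mulNr. Qed.

(** Primed letters stand for conjugates. For j <= i, with k = (i - j) + l, the value is (a b)^(i -
    j) (a a')^j (b b')^l, and the powers of 1/2 cancel the factor 2 of the Hopf map; the other case
    is conjugate. *)
Lemma meval_hopf_poly (v : 'I_3 -> K) i j k l (a a' b b' : K) :
  (i + l = j + k)%N ->
  v 0 = a * a' - b * b' -> a * a' + b * b' = 1 ->
  v 1 + c * v 2 = 2 * a * b -> v 1 - c * v 2 = 2 * a' * b' ->
  meval v (hopf_poly i j k l) = a ^+ i * a' ^+ j * (b ^+ k * b' ^+ l).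
Proof.
move=> ijkl v0 s3 e e'; rewrite /hopf_poly ijkl eqxx.
have half n (x y : K) : 2^-1 ^+ n * (2 * x * y) ^+ n = (x * y) ^+ n.
  by rewrite -exprMn; congr (_ ^+ n); field.
have u : meval v (upper K) = a * a'.
  by rewrite /upper mevalZ mevalD meval1 mevalXU v0 -[X in X + _]s3; field.
have w : meval v (lower K) = b * b'.
  by rewrite /lower mevalZ mevalB meval1 mevalXU v0 -[X in X - _]s3; field.
case: leqP => ij; rewrite mevalZ !mevalM !rmorphXn/= meval_cvar u w ?mulNr ?e ?e'.
  rewrite [LHS]mulrA half (_ : a ^+ i = a ^+ (i - j) * a ^+ j); last by rewrite -exprD subnK.
  have -> : (k = (i - j) + l)%N by lia.
  by rewrite exprD !exprMn; ring.
rewrite [LHS]mulrA half (_ : a' ^+ j = a' ^+ (j - i) * a' ^+ i); last by rewrite -exprD subnK// ltnW.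
have -> : (l = (j - i) + k)%N by lia.
by rewrite exprD !exprMn; ring.
Qed.

End hopf_poly.

(** * Designs on the fibers *)

Local Open Scope complex_scope.

Section evaluation.
Context {R : realType}.
Local Notation C := R[i].
Implicit Types (z : C) (x : C * C) (y : C * R).

Lemma sphere_mean_functional d :
  sphere_functional (K := R[i]) (@sphere_mean R d).
Proof.
split; [exact: sphere_mean1|exact: sphere_meanD|exact: sphere_meanZ|].
exact: sphere_meanX_rec.
Qed.

Lemma Re_plus_Im z : (complex.Re z)%:C + 'i * (complex.Im z)%:C = z.
Proof. by rewrite -complexE. Qed.

Lemma Re_minus_Im z : (complex.Re z)%:C - 'i * (complex.Im z)%:C = conjc z.
Proof.
by case: z => a b; apply/eqP; rewrite eq_complex /=; apply/andP; split; apply/eqP; ring.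
Qed.

Lemma polyfun_circleX z n : polyfun (cvar (d := 1) 'i 0 1 ^+ n) (of_C z) = z ^+ n.
Proof.
rewrite /polyfun; apply: etrans (rmorphXn _ _ _) _; congr (_ ^+ n).
by apply: etrans (meval_cvar _ _ _ _) _; rewrite !(tnth_nth 0)/= Re_plus_Im.
Qed.

Lemma polyfun_circleNX z n :
  polyfun (cvar (d := 1) (- 'i) 0 1 ^+ n) (of_C z) = conjc z ^+ n.
Proof.
rewrite /polyfun; apply: etrans (rmorphXn _ _ _) _; congr (_ ^+ n).
by apply: etrans (meval_cvar _ _ _ _) _; rewrite !(tnth_nth 0)/= mulNr Re_minus_Im.
Qed.

Lemma polyfun_bimonomial i j k l x :
  polyfun (bimonomial 'i i j k l) (of_CxC x) =
  x.1 ^+ i * conjc x.1 ^+ j * (x.2 ^+ k * conjc x.2 ^+ l).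
Proof.
rewrite /polyfun; apply: etrans (meval_bimonomial _ _ _ _ _ _) _.
by rewrite !(tnth_nth 0)/= !Re_plus_Im !Re_minus_Im.
Qed.

Lemma mul_conjc_normc z : z * conjc z = (normc z ^+ 2)%:C.
Proof.
case: z => a b; rewrite /normc sqr_sqrtr ?addr_ge0 ?sqr_ge0//.
by apply/eqP; rewrite eq_complex /=; apply/andP; split; apply/eqP; ring.
Qed.

Lemma of_C_inj : injective (@of_C R).
Proof. by move=> [a b] [c d] [-> ->]. Qed.

Lemma of_RxC_inj : injective (@of_RxC R).
Proof. by move=> [r [a b]] [s [c d]] [-> -> ->]. Qed.

Lemma of_CxC_inj : injective (@of_CxC R).
Proof. by move=> [[a b] [c d]] [[a' b'] [c' d']] [-> -> -> ->]. Qed.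

Lemma sphere_of_C z : @sphere R 1 (of_C z) -> z * conjc z = 1.
Proof.
rewrite /sphere/= => h; rewrite mul_conjc_normc -[RHS](rmorph1 (real_complex R)).
congr _%:C; rewrite -(expr1n _ 2) -h enorm_sqr 2!big_ord_recl big_ord0 addr0.
by rewrite !(tnth_nth 0)/=; case: z {h} => a b; rewrite /normc sqr_sqrtr ?addr_ge0 ?sqr_ge0.
Qed.

Lemma sphere_of_CxC x : S3 x -> @sphere R 3 (of_CxC x).
Proof.
move=> h; rewrite /sphere/= /enorm 4!big_ord_recl big_ord0 addr0.
rewrite !(tnth_nth 0)/=; rewrite /S3/= in h; move: h.
case: x => [[a b] [c d]]; rewrite /normc/= !sqr_sqrtr ?addr_ge0 ?sqr_ge0// => h.
by rewrite !addrA in h *; rewrite h sqrtr1.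
Qed.

Lemma design_mean d t (X : {fset (d.+1).-tuple (measurableTypeR R)}) (p : mpoly d.+1 C) :
  is_design t X -> (msize p <= t.+1)%N ->
  \sum_(x <- X) polyfun p x = #|` X|%:R * sphere_mean p.
Proof.
move=> [_ /(_ p)] h /h; rewrite -/(sphere_mean p) => <-.
have [X0|X0] := eqVneq (#|` X|) 0%N.
  by move/cardfs0_eq: X0 => ->; rewrite big_seq_fset0 !mulr0.
by rewrite mulVKf// pnatr_eq0.
Qed.

(** The constant 1 has mean 1, whereas its average over the empty set is 0 by the convention on the
    inverse of 0. *)
Lemma design_neq0 d t (X : {fset (d.+1).-tuple (measurableTypeR R)}) :
  is_design t X -> #|` X| != 0%N.
Proof.
move=> [_ /(_ 1)]; rewrite msize1 -/(sphere_mean _) sphere_mean1 => /(_ isT) h.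
by apply: contra_eq_neq h => ->; rewrite invr0 mul0r eq_sym oner_neq0.
Qed.

Lemma sum_imfset_inj (I J : choiceType) (V : nmodType) (h : I -> J) (A : {fset I}) (F : J -> V) :
  injective h -> \sum_(j <- [fset h i | i in A]%fset) F j = \sum_(i <- A) F (h i).
Proof. by move=> hI; rewrite big_imfset//= => a b _ _; exact: hI. Qed.

Lemma card_imfset_inj (I J : choiceType) (h : I -> J) (A : {fset I}) :
  injective h -> #|` [fset h i | i in A]%fset| = #|` A|.
Proof. exact: card_imfset. Qed.

(** On the circle conj z is the inverse of z, so each term is a power of z or of conj z with
    exponent |m - n|, of mean 0 unless m = n. *)
Lemma S1_design_sum t (G : {fset C}) m n :
  S1_design t G -> (m + n <= t)%N ->
  \sum_(z <- G) z ^+ m * conjc z ^+ n = (m == n)%:R * #|` G|%:R.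
Proof.
move=> dG mnt.
have zz z : z \in G -> z * conjc z = 1.
  by move=> zG; apply: sphere_of_C; apply: dG.1; apply/imfsetP; exists z.
have sumG (p : mpoly 2 C) : (msize p <= t.+1)%N ->
    \sum_(z <- G) polyfun p (of_C z) = #|` G|%:R * sphere_mean p.
  move=> pt; rewrite -(sum_imfset_inj _ _ of_C_inj) -(card_imfset_inj _ of_C_inj).
  exact: (design_mean dG pt).
have fsm := sphere_mean_functional 1.
have sz c k : (k <= t)%N -> (msize (cvar (d := 1) (c : C) 0 1 ^+ k)%R <= t.+1)%N.
  by move=> kt; apply: leq_trans (homog_msize_le (cvarX_homog c 0 1 k)) _.
case: (ltngtP m n) => mn; last first.
- rewrite mul1r mn (eq_big_seq (fun=> 1)) => [|z zG]; last first.
    by rewrite -exprMn zz// expr1n.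
  by rewrite big_const_seq count_predT iter_addr_0.
- rewrite mul0r (eq_big_seq (fun z => z ^+ (m - n))) => [|z zG]; last first.
    by rewrite -{1}(subnK (ltnW mn)) exprD -mulrA -exprMn zz// expr1n mulr1.
  under eq_bigr do rewrite -polyfun_circleX.
  rewrite sumG; last by apply: sz; lia.
  have -> : (m - n = (m - n).-1.+1)%N by lia.
  by rewrite (sf_S1_cvar_pow fsm)// ?mulr0// sqr_i.
- rewrite mul0r (eq_big_seq (fun z => conjc z ^+ (n - m))) => [|z zG]; last first.
    by rewrite -{1}(subnK (ltnW mn)) exprD mulrCA -exprMn zz// expr1n mulr1.
  under eq_bigr do rewrite -polyfun_circleNX.
  rewrite sumG; last by apply: sz; lia.
  have -> : (n - m = (n - m).-1.+1)%N by lia.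
  by rewrite (sf_S1_cvar_pow fsm)// ?mulr0// sqrrN sqr_i.
Qed.

End evaluation.

(** * Sums over the Hopf fibers *)

Section hopf_fiber.
Context {R : realType}.
Local Notation C := R[i].

(** A point of S^3 has a nonzero coordinate, from which [z] is recovered by cancellation. *)
Lemma act_inj (s : C * C) : S3 s -> injective (act s).
Proof.
case: s => a b; rewrite /S3/= => ab z w [az bz].
have [a0|a0] := eqVneq a 0; last exact: (mulfI a0).
have b0 : b != 0.
  apply/eqP => b0; move: ab; rewrite a0 b0 normc0 expr0n addr0 => /eqP.
  by rewrite eq_sym oner_eq0.
by apply: (can_inj (@conjcK R)); exact: (mulfI b0).
Qed.

Lemma normc_circle (z : C) : z * conjc z = 1 -> normc z ^+ 2 = 1.
Proof. by rewrite mul_conjc_normc => /(congr1 (@complex.Re R)). Qed.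

Lemma normc_conjc (z : C) : normc (conjc z) = normc z.
Proof. by case: z => a b; rewrite /normc/= sqrrN. Qed.

Lemma act_fiber (y : R * C) s z : hopf_fiber y s -> z * conjc z = 1 ->
  hopf_fiber y (act s z).
Proof.
move=> [s3 hs] z1; have nz := normc_circle z1; split.
  by rewrite /S3/= !normcM normc_conjc !exprMn nz !mulr1.
rewrite -hs /hopf/= !normcM normc_conjc !exprMn nz !mulr1; congr pair.
by rewrite -mulrA mulrACA z1 mulr1 mulrA.
Qed.

Lemma fiber_design_sub t y G x : fiber_design (R := R) t y G -> x \in G -> hopf_fiber y x.
Proof.
move=> [s [G' [hs dG ->]]] /imfsetP[z /= zG ->]; apply: act_fiber => //.
by apply: sphere_of_C; apply: dG.1; apply/imfsetP; exists z.
Qed.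

Lemma polyfun_hopf_poly y (s : C * C) i j k l : hopf_fiber y s -> (i + l = j + k)%N ->
  polyfun (hopf_poly 'i i j k l) (of_RxC y) = polyfun (bimonomial 'i i j k l) (of_CxC s).
Proof.
move=> [s3 <-] ijkl; rewrite polyfun_bimonomial /polyfun.
apply: etrans (meval_hopf_poly (a := s.1) (a' := conjc s.1) (b := s.2) (b' := conjc s.2) ijkl _ _ _ _) _ => //;
  rewrite ?(tnth_nth 0)/= ?mul_conjc_normc.
- by rewrite rmorphB.
- by rewrite -rmorphD s3.
- by rewrite Re_plus_Im.
- by rewrite Re_minus_Im !rmorphM rmorph_nat.
Qed.

(** Moving the base point by [z] multiplies the bimonomial by z^(i + l) (conj z)^(j + k), whose
    exponents add up to at most [t]. The circle design leaves only i + l = j + k, where the value at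
    the base point is that of [hopf_poly] at [y]. *)
Lemma fiber_sum t y (G : {fset C * C}) i j k l :
  fiber_design t y G -> (i + j + k + l <= t)%N ->
  \sum_(x <- G) polyfun (bimonomial 'i i j k l) (of_CxC x) =
  #|` G|%:R * polyfun (hopf_poly 'i i j k l) (of_RxC y).
Proof.
move=> [s [G' [hs dG ->]]] ijkl; have sI := act_inj hs.1.
rewrite sum_imfset_inj// card_imfset_inj//.
rewrite (eq_bigr (fun z => polyfun (bimonomial 'i i j k l) (of_CxC s) *
    (z ^+ (i + l) * conjc z ^+ (j + k)))) => [|z _]; last first.
  by rewrite !polyfun_bimonomial /= !rmorphM/= conjcK !exprMn !exprD; ring.
rewrite -mulr_sumr (S1_design_sum dG); last by lia.
have [h|h] := eqVneq (i + l)%N (j + k)%N.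
  by rewrite mul1r (polyfun_hopf_poly hs h) mulrC.
by rewrite mul0r mulr0 /hopf_poly (negbTE h) /polyfun meval0 mulr0.
Qed.

End hopf_fiber.

(** * Averaging over the union of the fiber designs *)

Theorem theorem1p1 (R : realType) (t : nat) (Y : {fset R * R[i]})
    (Gamma : {fset R[i]}) (k : nat)
    (Gamma_ : R * R[i] -> {fset R[i] * R[i]}) :
  k = (2 * t)%N \/ k = (2 * t + 1)%N ->
  S2_design t Y ->
  S1_design k Gamma ->
  (forall y, y \in Y ->
     fiber_design k y (Gamma_ y) /\ #|` Gamma_ y| = #|` Gamma|) ->
  S3_design k (\bigcup_(y <- Y) Gamma_ y)%fset /\
  #|` (\bigcup_(y <- Y) Gamma_ y)%fset| = (\sum_(y <- Y) #|` Gamma_ y|)%N.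
Proof.
move=> kt dY dG fG; set X := (\bigcup_(y <- Y) Gamma_ y)%fset.
(* A point lies only in the fiber over its Hopf image. *)
have disj y y' : y \in Y -> y' \in Y -> y != y' -> [disjoint Gamma_ y & Gamma_ y']%fset.
  move=> yY y'Y; apply: contra_neqT; rewrite -fsetI_eq0 => /fset0Pn[x].
  rewrite inE => /andP[xy xy'].
  have [_ <-] := fiber_design_sub (fG y yY).1 xy.
  by have [_ <-] := fiber_design_sub (fG y' y'Y).1 xy'.
have cardX : #|` X| = (\sum_(y <- Y) #|` Gamma_ y|)%N.
  rewrite card_fset_sum1 partition_disjoint_bigfcup//.
  by apply: eq_bigr => y _; rewrite -card_fset_sum1.
split=> //.
(* Equal sizes on the fibers give all points of [Y] the same weight in the average over [X]. *)
have cardX' : #|` X| = (#|` Y| * #|` Gamma|)%N.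
  rewrite cardX (eq_big_seq (fun=> #|` Gamma|)) => [|y /fG[]//].
  by rewrite big_const_seq count_predT iter_addn_0 mulnC.
have G0 : #|` Gamma| != 0%N.
  by rewrite -(card_imfset_inj _ (@of_C_inj R)); exact: (design_neq0 dG).
have Y0 : #|` Y| != 0%N.
  by rewrite -(card_imfset_inj _ (@of_RxC_inj R)); exact: (design_neq0 dY).
have X0 : #|` X|%:R != 0 :> R[i] by rewrite pnatr_eq0 cardX' muln_eq0 negb_or Y0.
split=> [_ /imfsetP[x /= /bigfcupP[y /andP[yY _] xy] ->]|p pk].
  by apply: sphere_of_CxC; have [] := fiber_design_sub (fG y yY).1 xy.
rewrite -/(sphere_mean p) (card_imfset_inj _ (@of_CxC_inj R)) (sum_imfset_inj _ _ (@of_CxC_inj R)).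
apply: (mulfI X0); rewrite mulVKf//.
(* Cleared of its denominator, the design identity is linear in [q], which reduces it to bimonomials
   of degree at most [k]. *)
pose H (q : mpoly 4 R[i]) :=
  \sum_(x <- X) polyfun q (of_CxC x) = #|` X|%:R * sphere_mean q.
apply: (bimonomial_span (H := H) (sqr_i R) _ _ _ pk).
- move=> q r; rewrite /H => hq hr; rewrite polyfunD big_split/= hq hr -mulrDr.
  by congr (_ * _); rewrite sphere_meanD.
- move=> a q; rewrite /H => hq; rewrite polyfunZ -mulr_sumr hq mulrCA.
  by congr (_ * _); rewrite sphere_meanZ.
move=> i j m n ijmn; rewrite /H partition_disjoint_bigfcup//.
rewrite (eq_big_seq (fun y => #|` Gamma|%:R * polyfun (hopf_poly 'i i j m n) (of_RxC y))); last first.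
  by move=> y yY; have [fy <-] := fG y yY; exact: fiber_sum fy ijmn.
rewrite -mulr_sumr -(sum_imfset_inj _ _ (@of_RxC_inj R)).
(* For both values of [k] the degree downstairs is at most [t], so the design property of [Y]
   applies. *)
have szh : (msize (hopf_poly ('i : R[i]) i j m n) <= t.+1)%N.
  by apply: msize_hopf_poly; case: kt ijmn => ->; lia.
rewrite (design_mean dY szh) (card_imfset_inj _ (@of_RxC_inj R)).
rewrite (sf_hopf_poly (sqr_i R) _ _ _ _ (sphere_mean_functional 2) (sphere_mean_functional 3)).
by rewrite cardX' natrM mulrA [X in X * _]mulrC.
Qed.
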